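(* Let $\mathfrak{F}$ be a saturated formation containing the class $\mathfrak{U}$ of all finite supersolvable groups, and let $G$ be a finite group. Then $G\in\mathfrak{F}$ if and only if there exists a normal subgroup $H$ of $G$ such that $G/H\in\mathfrak{F}$ and, for every prime $p$ and any non-cyclic Sylow $p$-subgroup $P$ of $H$, every cyclic subgroup $L$ of $P$ of prime order or of order $4$ (the latter when $p=2$ and $P$ is non-abelian) not contained in $Z_{\infty}(G)$ either has a supersolvable supplement in $G$ or satisfies $(\triangle)$ in $G$.
   Context: All groups are finite. A formation is a class $\mathfrak{F}$ of finite groups closed under isomorphism, quotients and such that $G/M,G/N\in\mathfrak{F}$ implies $G/(M\cap N)\in\mathfrak{F}$ for $M,N\unlhd G$; it is saturated if $G/\Phi(G)\in\mathfrak{F}$ implies $G\in\mathfrak{F}$, where $\Phi(G)$ is the Frattini subgroup. $Z_\infty(G)$ is the hypercenter of $G$ (the last term of the upper central series). A supplement of a subgroup $L$ in $G$ is a subgroup $T\leq G$ with $G=LT$. ''Either ... or'' is inclusive. $(a,b)$ denotes the greatest common divisor of integers $a,b$. Let $L\leq G$. Two subgroups $A,B$ permute if $AB=BA$. - $L$ is S-quasinormal in $G$ if $L$ permutes with every Sylow subgroup of $G$. - $L$ is S-quasinormally embedded in $G$ if every Sylow subgroup of $L$ is a Sylow subgroup of some S-quasinormal subgroup of $G$. - $L$ is $\tau$-quasinormal in $G$ if $L$ permutes with all Sylow $q$-subgroups $Q$ of $G$ (for all primes $q$) such that $(q,|L|)=1$ and $(|L|,|Q^G|)\neq 1$, where $Q^G$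 is the normal closure of $Q$ in $G$. - $L_{seG}$ is the subgroup generated by all subgroups of $L$ which are S-quasinormally embedded in $G$; $L_{\tau G}$ is the subgroup generated by all subgroups of $L$ which are $\tau$-quasinormal in $G$. - $L$ is weakly S-embedded in $G$ if there is $K\unlhd G$ such that $LK$ is S-quasinormal in $G$ and $L\cap K\leq L_{seG}$. - $L$ is weakly $\tau$-embedded in $G$ if there is $K\unlhd G$ such that $LK$ is S-quasinormal in $G$ and $L\cap K\leq L_{\tau G}$. - $L$ satisfies $(\triangle)$ in $G$ if $L$ is weakly S-embedded or weakly $\tau$-embedded in $G$. *)

(* Defs.v *)
From HB Require Import structures.
From mathcomp Require Import all_boot all_fingroup all_solvable.

Set Implicit Arguments.
Unset Strict Implicit.
Unset Printing Implicit Defensive.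

Local Open Scope group_scope.

Definition group_class := forall gT : finGroupType, {group gT} -> Prop.

Definition formation (F : group_class) : Prop :=
  [/\ forall (gT rT : finGroupType) (G : {group gT}) (H : {group rT}),
        G \isog H -> F gT G -> F rT H,
      forall (gT : finGroupType) (G N : {group gT}),
        N <| G -> F gT G -> F (coset_of N) (G / N)%G
    & forall (gT : finGroupType) (G M N : {group gT}),
        M <| G -> N <| G ->
        F (coset_of M) (G / M)%G -> F (coset_of N) (G / N)%G ->
        F (coset_of (M :&: N)) (G / (M :&: N))%G].

Definition saturated (F : group_class) : Prop :=
  forall (gT : finGroupType) (G : {group gT}),
    F (coset_of 'Phi(G)) (G / 'Phi(G))%G -> F gT G.

(* A series 1 = G_0 <= ... <= G_n = G of normal subgroups of G with cyclic    *)
(* factors.                                                                   *)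
Definition supersolvable (gT : finGroupType) (G : {group gT}) : Prop :=
  exists2 s : seq {group gT},
    path (fun U V : {group gT} => [&& V <| G, U \subset V & cyclic (V / U)])
         1%G s
    & last 1%G s = G.

Section Embeddings.

Variable gT : finGroupType.
Implicit Types (A : {set gT}) (G K L P Q T : {group gT}).

(* The upper central series is stationary from the term #|G| on; see          *)
(* hypercenter_last.                                                          *)
Definition hypercenter G : {set gT} := 'Z_(#|G|)(G).

Lemma hypercenter_last G n : 'Z_n(G) \subset hypercenter G.
Proof.
suff [m le_mG Em]: exists2 m, m <= #|G| & 'Z_m.+1(G) = 'Z_m(G).
  have st k : 'Z_(m + k)(G) = 'Z_m(G).
    by elim: k => [|k IHk]; rewrite ?addn0 // addnS -Em !ucnSn IHk.
  apply: subset_trans (ucn_sub_geq G le_mG).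
  have [/ucn_sub_geq-> //|/ltnW/subnKC <-] := leqP n m.
  by rewrite st.
suff /existsP[m /eqP Em]: [exists m : 'I_#|G|.+1, 'Z_m.+1(G) == 'Z_m(G)].
  by exists (nat_of_ord m); rewrite // -ltnS.
apply: contraT => /existsPn neZ.
have lt_card m : m <= #|G|.+1 -> m < #|'Z_m(G)|.
  elim: m => [|m IHm] lt_m; first exact: cardG_gt0.
  apply: leq_ltn_trans (IHm (ltnW lt_m)) _; apply: proper_card.
  by rewrite properEneq eq_sym (neZ (Ordinal lt_m)) ucn_subS.
have /leq_trans/(_ (subset_leq_card (ucn_sub #|G|.+1 G))) := lt_card _ (leqnn _).
by rewrite ltnNge leqnSn.
Qed.

(* Stated for a subset A, so that it applies to a product L * K; A is meant   *)
(* to be a subgroup of G.                                                     *)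
Definition s_quasinormal G A : bool :=
  [forall Q : {group gT}, Sylow G Q ==> (A * Q == Q * A)].

Lemma s_quasinormalP G A :
  reflect (forall (q : nat) Q, prime q -> q.-Sylow(G) Q -> A * Q = Q * A)
          (s_quasinormal G A).
Proof.
apply: (iffP forall_inP) => [sqA q Q _ sylQ | sqA Q /SylowP[q q_pr sylQ]].
  by apply/eqP/sqA/(p_Sylow sylQ).
exact/eqP/(sqA q).
Qed.

Definition s_quasinormally_embedded G L : bool :=
  [forall P : {group gT}, Sylow L P ==>
     [exists K : {group gT},
        [&& K \subset G, s_quasinormal G K & Sylow K P]]].

Definition normal_closure A G : {set gT} := <<class_support A G>>.

(* The primes q not dividing #|G| are irrelevant: their Sylow subgroup is     *)
(* trivial; see tau_quasinormalP.                                             *)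
Definition tau_quasinormal G L : bool :=
  [forall Q : {group gT}, all (fun q =>
     [&& q.-Sylow(G) Q, coprime q #|L| & gcdn #|L| #|normal_closure Q G| != 1%N]
       ==> (L * Q == Q * L)) (primes #|G|)].

Lemma tau_quasinormalP G L :
  reflect (forall (q : nat) Q, prime q -> q.-Sylow(G) Q ->
             coprime q #|L| -> gcdn #|L| #|normal_closure Q G| <> 1%N ->
             L * Q = Q * L)
          (tau_quasinormal G L).
Proof.
apply: (iffP forallP) => [tauL q Q q_pr sylQ coqL /eqP ngcd | tauL Q].
  have [qG | q'G] := boolP (q \in primes #|G|).
    by have /allP/(_ q qG) := tauL Q; rewrite sylQ coqL ngcd => /eqP.
  have/eqP-> : Q :==: 1; last by rewrite mulg1 mul1g.
  rewrite trivg_card1 (card_Hall sylQ) p_part lognE.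
  by move: q'G; rewrite mem_primes q_pr => /negPf->.
apply/allP=> q; rewrite mem_primes => /and3P[q_pr _ _].
by apply/implyP=> /and3P[sylQ coqL /eqP ngcd]; apply/eqP/(tauL q).
Qed.

Definition seG_core G L : {set gT} :=
  <<\bigcup_(K : {group gT} | (K \subset L) && s_quasinormally_embedded G K) K>>.

Definition tauG_core G L : {set gT} :=
  <<\bigcup_(K : {group gT} | (K \subset L) && tau_quasinormal G K) K>>.

Definition weakly_s_embedded G L : Prop :=
  exists K, [/\ K <| G, s_quasinormal G (L * K) & L :&: K \subset seG_core G L].

Definition weakly_tau_embedded G L : Prop :=
  exists K, [/\ K <| G, s_quasinormal G (L * K) & L :&: K \subset tauG_core G L].

Definition satisfies_triangle G L : Prop :=
  weakly_s_embedded G L \/ weakly_tau_embedded G L.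

Definition has_supersolvable_supplement G L : Prop :=
  exists T, [/\ T \subset G, L * T = G & supersolvable T].

End Embeddings.

(* Main.v *)
Require Import Defs.
From HB Require Import structures.
From mathcomp Require Import all_boot all_fingroup all_solvable.
From mathcomp Require Import all_algebra all_field all_character finmodule.

Set Implicit Arguments.
Unset Strict Implicit.
Unset Printing Implicit Defensive.
Local Open Scope group_scope.

(** One direction takes H = 1. For the other, let O^p(G) be the subgroup
    generated by the p'-elements of G, and let B(G) be the subgroup generated
    by G' and the (p-1)-th powers of elements of G, so that G / B(G) is abelian
    of exponent dividing p - 1. A normal p-subgroup P of G has only cyclic
    G-chief factors as soon as O^p(B(G)) centralises P, and a saturated
    formation F containing the supersolvable groups then contains G whenever
    it contains G / P (formation_p_extension).

    All the alternatives of the hypothesis on a cyclic subgroup <x> (embedding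
    in the hypercenter, supersolvable supplement, the two weak embeddings)
    share one consequence, called res_stable below: there is an invariant
    subgroup R that avoids x such that the p'-elements normalise <x>R.

    The core is strict_residual_cent_pgroup: if U is a p-group normalised by
    G and every x of order p in [U, G] (or of order 4, when p = 2 and U is not
    abelian) is res_stable, then O^p(B(G)) centralises U. In a minimal
    G-invariant counterexample W, all the nontrivial elements have order p (or
    4), and E = C_W(O^p(B(G))) is the largest proper invariant subgroup; then
    O^p(G) normalises every line of W / E, a Sylow p-subgroup of G fixes one of
    these lines, so W / E has order p and B(G) acts trivially on it.

    This is used twice. If p is the smallest prime divisor of |H|, then for
    U a p-subgroup of H and N_H(U) acting, the p'-elements have order prime to
    p - 1, so they centralise U; by the criterion of Frobenius, H has the
    normal p-complement K = O^p(H). Then, with P a Sylow p-subgroup of H acted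
    on by N_G(P), the Frattini argument transfers the conclusion to G / K and
    gives G / K in F. The hypothesis passes to K, whose Sylow subgroups
    are Sylow in H, and induction on |H| concludes. *)

(** * Subgroups generated by p'-elements, commutators and (p-1)-th powers *)

(** If c = [w, z] commutes with z, then c^n = [w, z^n], so the order of c
    divides that of z. *)
Lemma coprime_commute (gT : finGroupType) (w z : gT) :
  commute [~ w, z] z -> coprime #[[~ w, z]] #[z] -> commute w z.
Proof.
move=> cz co; apply/commgP.
have: [~ w, z] ^+ #[z] = 1 by rewrite -commgX ?expg_order ?commg1 //; exact/commute_sym.
by move/eqP; rewrite -order_dvdn -order_eq1 => /gcdn_idPl <-; rewrite -/(coprime _ _).
Qed.

Section Residuals.
Variables (p : nat) (gT : finGroupType).
Implicit Types G H S W U : {group gT}.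

(** For a group A, the smallest normal subgroup with a p-group as quotient,
    usually written O^p(A). *)
Definition p_residual (A : {set gT}) := <<[set z in A | p^'.-elt z]>>.
Canonical p_residual_group A := [group of p_residual A].

Lemma p_residual_sub G : p_residual G \subset G.
Proof. by rewrite gen_subG; apply/subsetP=> z /setIdP[]. Qed.

Lemma mem_p_residual (A : {set gT}) z : z \in A -> p^'.-elt z -> z \in p_residual A.
Proof. by move=> Az p'z; rewrite mem_gen // inE Az. Qed.

Lemma p_residual_subP (A : {set gT}) G :
  reflect (forall z, z \in A -> p^'.-elt z -> z \in G) (p_residual A \subset G).
Proof.
rewrite gen_subG; apply: (iffP subsetP) => sAG z => [Az p'z | /setIdP[]].
  by apply: sAG; rewrite inE Az.
exact: sAG.
Qed.

Lemma p_residual_norm G H : G \subset 'N(H) -> G \subset 'N(p_residual H).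
Proof.
move=> nHG; apply/norms_gen/normsP=> x Gx; apply/setP=> z.
by rewrite mem_conjg !inE -mem_conjg (normsP nHG) // /p_elt orderJ.
Qed.

(** A group is generated by its Sylow subgroups, and those for the primes
    other than p consist of p'-elements. *)
Lemma sub_p_residual_Sylow G S :
  p.-Sylow(G) S -> G \subset p_residual G <*> S.
Proof.
move=> sylS; set T :=
  [set P : {group gT} | (P \subset G) && (P \subset p_residual G <*> S)].
have defG: <<\bigcup_(P in T) P>> = G.
  apply: Sylow_transversal_gen; first by move=> P; rewrite inE => /andP[].
  move=> q _; have [->|ne_qp] := eqVneq q p.
    by exists S; rewrite // inE (pHall_sub sylS) joing_subr.
  have [Q sylQ] := Sylow_exists q G; exists Q => //.
  rewrite inE (pHall_sub sylQ) (subset_trans _ (joing_subl _ _)) //.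
  apply/subsetP=> z Qz; apply: mem_p_residual; first exact: (subsetP (pHall_sub sylQ)).
  apply: sub_p_elt (mem_p_elt (pHall_pgroup sylQ) Qz) => r.
  by rewrite !inE => /eqP->.
rewrite -{1}defG gen_subG; apply/bigcupsP=> P.
by rewrite inE => /andP[].
Qed.

(** For a group A, the smallest normal subgroup with an abelian quotient of
    exponent dividing p - 1; every action of A on a group of order p factors
    through this quotient. *)
Definition strict_residual (A : {set gT}) : {set gT} :=
  A^`(1) <*> [set x ^+ p.-1 | x in A].
Canonical strict_residual_group A := [group of strict_residual A].

Lemma strict_residual_sub G : strict_residual G \subset G.
Proof.
rewrite join_subG der_sub; apply/subsetP=> _ /imsetP[x Gx ->].
exact: groupX.
Qed.

Lemma strict_residual_normal G : strict_residual G <| G.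
Proof. by apply: sub_der1_normal (strict_residual_sub G); rewrite joing_subl. Qed.

Lemma strict_residual_minP G H :
  reflect (G^`(1) \subset H /\ forall x, x \in G -> x ^+ p.-1 \in H)
          (strict_residual G \subset H).
Proof.
rewrite join_subG; apply: (iffP andP) => [[-> sXH]|[-> sXH]]; split=> //.
  by move=> x Gx; apply: (subsetP sXH); apply: imset_f.
by apply/subsetP=> _ /imsetP[x Gx ->]; apply: sXH.
Qed.

(** The automorphism group of a group of order p is abelian of order p - 1. *)
Lemma strict_residual_cent_prime G W :
  prime p -> G \subset 'N(W) -> #|W| = p -> strict_residual G \subset 'C(W).
Proof.
move=> p_pr nWG oW; have cW: cyclic W by rewrite prime_cyclic ?oW.
have sAut: conj_aut W @* G \subset Aut W := Aut_conj_aut W G.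
apply/strict_residual_minP.
have kerC x : x \in G -> conj_aut W x = 1 -> x \in 'C(W).
  move=> Gx; have Nx := subsetP nWG x Gx => x1.
  by have: x \in 'ker (conj_aut W) by [apply/kerP]; rewrite ker_conj_aut.
split=> [|x Gx].
  rewrite /= -(ker_conj_aut W) ker_trivg_morphim (subset_trans (der_sub _ _) nWG) /=.
  rewrite morphim_der // (sameP trivgP derG1P).
  by apply: abelianS sAut (Aut_cyclic_abelian cW).
apply: kerC; rewrite ?groupX // morphX ?(subsetP nWG) //; apply/eqP.
rewrite -order_dvdn (dvdn_trans (order_dvdG (subsetP sAut _ (mem_morphim _ _ _)))) //.
  exact: (subsetP nWG).
by rewrite card_Aut_cyclic // oW totient_prime.
Qed.

End Residuals.

Lemma morphim_strict_residual p (aT rT : finGroupType) (D : {group aT})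
    (f : {morphism D >-> rT}) (G : {group aT}) :
  G \subset D -> f @* strict_residual p G = strict_residual p (f @* G).
Proof.
move=> sGD; rewrite morphimY ?(subset_trans (der_sub _ _)) //; last first.
  by apply/subsetP=> _ /imsetP[x Gx ->]; rewrite groupX ?(subsetP sGD).
rewrite morphim_der //; congr (_ <*> _); apply/setP=> y; apply/idP/idP.
  case/morphimP=> _ _ /imsetP[x Gx ->] ->; rewrite morphX ?(subsetP sGD) //.
  by apply: imset_f; rewrite mem_morphim ?(subsetP sGD).
case/imsetP=> _ /morphimP[x Dx Gx ->] ->; rewrite -morphX //.
by apply: mem_morphim; rewrite ?groupX //; apply: imset_f.
Qed.

Lemma p_residualS p (gT : finGroupType) (A B : {set gT}) :
  A \subset B -> p_residual p A \subset p_residual p B.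
Proof. by move=> sAB; apply/genS/subsetP=> z /[!inE]/andP[/(subsetP sAB)->]. Qed.

Lemma p_residual_morphim p (aT rT : finGroupType) (D : {group aT})
    (f : {morphism D >-> rT}) (G : {group aT}) :
  G \subset D -> p_residual p (f @* G) \subset f @* p_residual p G.
Proof.
move=> sGD; apply/p_residual_subP=> _ /morphimP[z Dz Gz ->] p'z.
rewrite -(constt_p_elt p'z) -morph_constt //.
have Gzp : z.`_p^' \in G by rewrite (subsetP _ _ (cycle_constt _ _)) ?cycle_subG.
by rewrite mem_morphim ?mem_p_residual ?p_elt_constt ?(subsetP sGD).
Qed.

Lemma strict_residual_quotient_cent p (gT : finGroupType) (G N P : {group gT}) :
    G \subset 'N(N) -> p_residual p (strict_residual p G) \subset 'C(P) ->
  p_residual p (strict_residual p (G / N)) \subset 'C(P / N).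
Proof.
move=> nNG cP; rewrite -morphim_strict_residual //.
apply: subset_trans (quotient_cents N cP); apply: p_residual_morphim.
exact: subset_trans (strict_residual_sub p G) nNG.
Qed.

(** * Centralising a p-group from its elements of order p and 4 *)

Section CriticalSection.
Variables (gT : finGroupType).
Implicit Type p : nat.
Implicit Types G S U W Z : {group gT}.

Lemma mem_Phi_exp p W x : p.-group W -> x \in W -> x ^+ p \in 'Phi(W).
Proof.
move=> pW Wx; rewrite (Phi_joing pW) mem_gen // inE.
by rewrite (Mho_p_elt 1 Wx (mem_p_elt pW Wx)) orbT.
Qed.

(** The n-th power map is then an endomorphism of W compatible with the action
    of Z; since its values are fixed by Z, it kills the commutators [w, z],
    which generate W. *)
Lemma exp_commutator_gen n W Z :
    Z \subset 'N(W) -> [~: W, Z] = W ->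
    {in W &, {morph expgn^~ n : x y / x * y}} ->
    (forall x, x \in W -> x ^+ n \in 'C(Z)) ->
  forall x, x \in W -> x ^+ n = 1.
Proof.
move=> nWZ defW XM cXZ; pose f := Morphism XM.
have: [~: W, Z] \subset 'ker f.
  rewrite gen_subG; apply/subsetP=> _ /imset2P[w z Ww Zz ->].
  have Wwz: w ^ z \in W by rewrite memJ_norm // (subsetP nWZ).
  have WR: [~ w, z] \in W by rewrite commgEl groupM ?groupV.
  apply/kerP=> //=; rewrite commgEl XM ?groupV //= expVgn.
  apply/eqP; rewrite -conjXg -eq_mulVg1 eq_sym; apply/eqP/conjg_fixP/commgP.
  exact: (centP (cXZ w Ww)).
rewrite defW => /subsetP sWK x /sWK /mker; exact.
Qed.

(** The three subgroup lemma makes Phi(W) central, so W has class at most 2 and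
    W' has exponent p. Hence the p-th power map is an endomorphism if p is odd
    or W is abelian, and the 4-th power map is one if p = 2, because the
    binomial coefficients C(p, 2) and C(4, 2) are then multiples of p. *)
Lemma exponent_commutator_gen p W Z :
    prime p -> p.-group W -> Z \subset 'N(W) -> [~: W, Z] = W ->
    Z \subset 'C('Phi(W)) ->
  forall x, x \in W -> x ^+ p = 1 \/ [/\ x ^+ 4 = 1, p = 2 & ~~ abelian W].
Proof.
move=> p_pr pW nWZ defW cZPhi.
have cPhiZ: 'Phi(W) \subset 'C(Z) by rewrite centsC.
have cWPhi: W \subset 'C('Phi(W)).
  apply/commG1P; rewrite -{1}defW (commGC W); apply: three_subgroup.
    have: [~: W, 'Phi(W)] \subset 'C(Z).
      by apply: subset_trans cPhiZ; rewrite commg_subr gFnorm.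
    by move/commG1P.
  by have/commG1P-> := cPhiZ; rewrite comm1G.
have Xp x : x \in W -> x ^+ p \in 'Phi(W) by apply: mem_Phi_exp.
have [cWW | ncWW] := boolP (abelian W).
  move=> x Wx; left; move: x Wx; apply: (@exp_commutator_gen p W Z) => //.
    by move=> x y Wx Wy; apply: expgMn; apply: (centsP cWW).
  by move=> x /Xp/(subsetP cPhiZ).
have cR x y u: x \in W -> y \in W -> u \in W -> commute u [~ x, y].
  move=> Wx Wy Wu; apply: (centsP cWPhi) => //.
  rewrite (Phi_joing pW) mem_gen // inE; apply/orP; left.
  by rewrite mem_commg.
have Rp x y : x \in W -> y \in W -> [~ x, y] ^+ p = 1.
  move=> Wx Wy; rewrite -commXg; last exact: cR.
  by apply/eqP/commgP/commute_sym/(centsP cWPhi); rewrite ?Xp.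
have XM n : p %| 'C(n, 2) -> {in W &, {morph expgn^~ n : x y / x * y}}.
  case/dvdnP=> k En x y Wx Wy /=.
  rewrite expMg_Rmul; try by apply: cR.
  by rewrite En mulnC expgM Rp // expg1n mulg1.
have [p2 | odd_p] := even_prime p_pr; last first.
  move=> x Wx; left; move: x Wx; apply: (@exp_commutator_gen p W Z) => //.
    by apply: XM; rewrite prime_dvd_bin //= odd_prime_gt2.
  by move=> x /Xp/(subsetP cPhiZ).
move=> x Wx; right; split=> //; move: x Wx.
apply: (@exp_commutator_gen 4 W Z) => //; first by apply: XM; rewrite p2.
move=> x /Xp; rewrite p2 => Phix; apply: (subsetP cPhiZ).
by rewrite (expgM x 2 2) groupX.
Qed.

(** The common consequence of the various embedding hypotheses on <x>. Working
    modulo R rather than with <x> itself accounts for the normal subgroup in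
    weak embeddings, the core of a supplement, and the terms of a normal series. *)
Definition res_stable p G x := exists R : {group gT},
  [/\ G \subset 'N(R), x \notin R & p_residual p G \subset 'N(<[x]> * R)].

(** Coprime action: a p'-element that centralises all the commutators of W with
    itself centralises W. *)
Lemma cent_p_residual_commutator p G W :
  p.-group W -> G \subset 'N(W) -> [~: [~: W, p_residual p G], p_residual p G] = 1 ->
  p_residual p G \subset 'C(W).
Proof.
move=> pW nWG /commG1P cc; apply/p_residual_subP=> z Gz p'z.
have Rz := mem_p_residual Gz p'z; apply/centP=> w Ww.
have Wwz: [~ w, z] \in W.
  by rewrite commgEl groupM ?groupV // memJ_norm // (subsetP nWG).
apply/commute_sym/coprime_commute.
  by apply: (centsP cc); rewrite // mem_commg.
exact: pnat_coprime (mem_p_elt pW Wwz) p'z.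
Qed.

(** Take W minimal among the G-invariant subgroups of U not centralised by
    Z = O^p(B(G)). Then W = [W, Z], which bounds the exponent of W, and
    E = C_W(Z) contains every proper invariant subgroup of W. For v in W
    outside E the witness R of res_stable meets W inside E, so that <v>E is
    invariant under O^p(G). A line fixed by a Sylow p-subgroup of G is
    then fixed by G, hence |W / E| = p, and Z acts trivially on W / E and
    on E, against the choice of W. *)
Theorem strict_residual_cent_pgroup p G U :
    prime p -> p.-group U -> G \subset 'N(U) ->
    (forall x, x \in [~: U, G] ->
       #[x] = p \/ [/\ #[x] = 4, p = 2 & ~~ abelian U] -> res_stable p G x) ->
  p_residual p (strict_residual p G) \subset 'C(U).
Proof.
move=> p_pr pU nUG stabU; apply: contraT => ncU.
set B := strict_residual p G; set Z := p_residual p B in ncU *.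
pose bad := [pred V : {group gT} |
  [&& V \subset U, G \subset 'N(V) & ~~ (Z \subset 'C(V))]].
have [|W /mingroupP[/and3P[sWU nWG ncW] minW] _] := @mingroup_exists _ bad U.
  by rewrite /bad /= subxx nUG.
have pW := pgroupS sWU pU.
have sBG: B \subset G := strict_residual_sub p G.
have sZB: Z \subset B := p_residual_sub p _.
have sZG := subset_trans sZB sBG.
have nBG: G \subset 'N(B) := normal_norm (strict_residual_normal p G).
have nZG: G \subset 'N(Z) := p_residual_norm p nBG.
have nWZ := subset_trans sZG nWG; have nWB := subset_trans sBG nWG.
have centZ (V : {group gT}) :
    V \subset W -> G \subset 'N(V) -> V :!=: W -> Z \subset 'C(V).
  move=> sVW nVG; apply: contraR => ncV; apply/eqP.
  by apply: minW => //=; rewrite (subset_trans sVW sWU) nVG.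
have defW: [~: W, Z] = W.
  apply/eqP; apply: contraR ncW => neWZ.
  apply: (cent_p_residual_commutator pW nWB).
  apply/commG1P; rewrite centsC; apply: (centZ [group of [~: W, Z]]) => //=.
    by rewrite commg_subl.
  by rewrite normsR.
have ntW: W :!=: 1 by apply: contraNneq ncW => ->; rewrite cents1.
have cZPhi: Z \subset 'C('Phi(W)).
  apply: (centZ [group of 'Phi(W)]); rewrite ?Phi_sub //=.
    exact: gFnorm_trans.
  by move: (Phi_proper ntW); rewrite properEneq => /andP[].
pose E := 'C_W(Z).
have nEG: G \subset 'N(E) by rewrite normsI // norms_cent.
have sEW: E \subset W := subsetIl _ _.
have PhiE: 'Phi(W) \subset E by rewrite subsetI Phi_sub centsC.
have invE (V : {group gT}) :
    V \subset W -> G \subset 'N(V) -> V :!=: W -> V \subset E.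
  by move=> sVW nVG neV; rewrite subsetI sVW centsC centZ.
have neEW: E != W.
  by apply: contraNneq ncW => defE; rewrite centsC; apply/setIidPl.
have nEW: W \subset 'N(E).
  apply: normal_norm; apply: sub_der1_normal sEW.
  by rewrite (subset_trans _ PhiE) // (Phi_joing pW) joing_subl.
(* R meets W in a proper invariant subgroup, so inside E: modulo E, the group
   <v>R becomes the line spanned by v. *)
have lineE v : v \in W -> v \notin E -> p_residual p G \subset 'N(<[v]> <*> E).
  move=> Wv E'v.
  have ov: #[v] = p \/ [/\ #[v] = 4, p = 2 & ~~ abelian U].
    have nt_v: v != 1 by apply: contraNneq E'v => ->.
    have ovp : v ^+ p = 1 -> #[v] = p.
      by move=> vp1; apply: nt_prime_order.
    have [/ovp|[v4 p2 ncWW]] := exponent_commutator_gen p_pr pW nWZ defW cZPhi Wv.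
      by left.
    have [/ovp|v2] := eqVneq (v ^+ p) 1; first by left.
    right; split=> //; last by apply: contra ncWW; apply: abelianS.
    rewrite p2 in v2 *; rewrite (@orderXprime _ 2 2) //.
    by rewrite (@nt_prime_order _ 2) // -expgM.
  have [|R [nRG R'v nvRG]] := stabU v _ ov.
    by rewrite (subsetP _ _ Wv) // -{1}defW commgSS.
  have sRE: R :&: W \subset E.
    apply: (invE [group of R :&: W]); rewrite ?subsetIr ?normsI //=.
    by apply: contraNneq R'v => /setIidPr/subsetP; apply.
  have ->: <[v]> <*> E = (<[v]> * R :&: W) * E.
    rewrite -group_modl ?cycle_subG // -mulgA (mulSGid sRE).
    by rewrite norm_joinEl // cycle_subG (subsetP nEW).
  have sA := p_residual_sub p G.
  by rewrite normsM ?(subset_trans sA nEG) // normsI // (subset_trans sA).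
have [S sylS] := Sylow_exists p G.
(* A nontrivial normal subgroup of a p-group meets the center: S centralises
   some nontrivial element of W / E. *)
have [v Wv [E'v nvS]]:
    exists2 v, v \in W & v \notin E /\ S \subset 'N(<[v]> <*> E).
  have sSG := pHall_sub sylS; have nES := subset_trans sSG nEG.
  have nWS := subset_trans sSG nWG.
  have pWS: p.-group ((W <*> S) / E).
    by rewrite quotient_pgroup //= norm_joinEr // pgroupM pW (pHall_pgroup sylS).
  have nsWS: W / E <| (W <*> S) / E.
    by rewrite quotient_normal // /normal joing_subl join_subG normG.
  have ntWE: W / E != 1.
    rewrite -subG1 quotient_sub1 //; apply: contra neEW => sWE.
    by rewrite eqEsubset sEW.
  have /trivgPn[_ /setIP[/morphimP[v nEv Wv ->] /setIP[_ /centP cv]] nt_v] :=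
    meet_center_nil (pgroup_nil pWS) nsWS ntWE.
  exists v => //; split; first by apply: contra nt_v => Ev; rewrite /= coset_id.
  rewrite -commg_subl (@subset_trans _ _ E) ?joing_subr //.
  rewrite -quotient_cents2 //; last first.
    by rewrite join_subG cycle_subG nEv normG.
  rewrite quotientYidr ?cycle_subG // quotient_cycle //.
  rewrite cycle_subG; apply/centP=> _ /morphimP[s nEs Ss ->].
  by apply: cv; rewrite mem_quotient // mem_gen // inE Ss orbT.
have defWv: W :=: <[v]> <*> E.
  apply/eqP; rewrite eq_sym eqEsubset join_subG cycle_subG Wv sEW /=.
  have: ~~ (<[v]> <*> E \subset E) by rewrite join_subG cycle_subG (negPf E'v).
  apply: contraR => sWE; apply: (invE [group of <[v]> <*> E]);
    rewrite ?join_subG ?cycle_subG ?Wv //=.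
    rewrite (subset_trans (sub_p_residual_Sylow sylS)) // join_subG nvS andbT.
    exact: lineE.
  by apply: contraNneq sWE => <-.
have oWE: #|W / E| = p.
  rewrite defWv quotientYidr ?cycle_subG ?(subsetP nEW) //.
  rewrite quotient_cycle ?(subsetP nEW) // -orderE; apply: nt_prime_order => //.
    rewrite -morphX ?(subsetP nEW) //; apply/coset_id/(subsetP PhiE).
    exact: mem_Phi_exp.
  apply: contra E'v => /eqP/coset_idr; apply; exact: (subsetP nEW).
have cBWE: B / E \subset 'C(W / E).
  rewrite [B / E]morphim_strict_residual //.
  by apply: strict_residual_cent_prime; rewrite ?quotient_norms.
rewrite (cent_p_residual_commutator pW nWB) in ncW => //.
apply/commG1P; rewrite (@subset_trans _ _ E) //; last exact: subsetIr.
rewrite -/Z; apply: subset_trans (commgS _ sZB) _.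
by rewrite -quotient_cents2 ?(subset_trans sBG) // centsC.
Qed.
End CriticalSection.

(** * Extending a saturated formation by a p-group *)

(** Over the field with p elements the polynomial X^p - X, which kills the
    action of g, splits into linear factors; so the minimal polynomial of g
    has a root, and g has an eigenvector. *)
Lemma abelem_eigenvector p (gT : finGroupType) (N : {group gT}) g :
    prime p -> p.-abelem N -> N :!=: 1 -> g \in 'N(N) -> g ^+ p.-1 \in 'C(N) ->
  exists2 n, n \in N^# & exists a, n ^ g = n ^+ a.
Proof.
move=> p_pr abelN ntN Ng cNg.
have nNg : <[g]> \subset 'N(N) by rewrite cycle_subG.
pose rG := abelem_repr abelN ntN nNg; pose M := rG g.
have gg := cycle_id g.
have M1 : rG (g ^+ p.-1) = 1%:M%R.
  apply/row_matrixP=> i; rewrite !rowE mulmx1.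
  apply: (@rVabelem_inj _ _ _ abelN ntN).
  rewrite rVabelemJ ?mem_cycle //; apply/conjg_fixP/commgP/commute_sym.
  by apply: (centP cNg); apply: mem_rVabelem.
have Mp : (horner_mx M ('X^p - 'X) = 0)%R.
  have MX k : (M ^+ k)%R = rG (g ^+ k).
    elim: k => [|k IHk]; first by rewrite expg0 repr_mx1.
    by rewrite GRing.exprS IHk expgS repr_mxM ?mem_cycle.
  rewrite GRing.rmorphB /= GRing.rmorphXn /= horner_mx_X.
  rewrite -[in X in (_ ^+ X)%R](prednK (prime_gt0 p_pr)) GRing.exprSr MX M1.
  by rewrite GRing.mul1r GRing.subrr.
have genX : ('X^p - 'X = \prod_(x : 'F_p) ('X - x%:P) :> {poly 'F_p})%R.
  by rewrite -finField_genPoly card_Fp.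
have := mxminpoly_min Mp; rewrite genX => /dvdp_prod_XsubC[m].
set s := mask m _ => eq_p.
have: exists a, root (mxminpoly M) a.
  have := mxminpoly_nonconstant M; rewrite -ltnS -size_mxminpoly (eqp_size eq_p).
  case: (s) eq_p => [|a s'] eq_p; first by rewrite big_nil size_poly1.
  by exists a; rewrite (eqp_root eq_p) big_cons rootM root_XsubC eqxx.
case=> a; rewrite -eigenvalue_root_min => /eigenvalueP[v vM ntv].
exists (rVabelem abelN ntN v).
  rewrite !inE mem_rVabelem andbT; apply: contraNneq ntv => v1.
  by apply/eqP; apply: (@rVabelem_inj _ _ _ abelN ntN); rewrite v1 morph1.
exists (val a); rewrite -(rVabelemJ abelN ntN nNg) //.
by rewrite vM rVabelemZ.
Qed.

(** The group acts on N through an abelian group of exponent dividing p - 1.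
    An eigenspace of one element is invariant under the whole group, so each
    element acts on N as a scalar, and any subgroup of order p is normal. *)
Lemma minnormal_prime p (gT : finGroupType) (G N : {group gT}) :
    prime p -> p.-group N -> minnormal N G -> strict_residual p G \subset 'C(N) ->
  #|N| = p.
Proof.
move=> p_pr pN minN /strict_residual_minP[cN' cNX].
have [/andP[ntN nNG] minN1] := mingroupP minN.
have abelN : p.-abelem N.
  have [_ _] := minnormal_solvable minN (subxx _) (pgroup_sol pN).
  by rewrite (is_abelem_pgroup pN).
have [_ cNN Np] := and3P abelN; have {}Np n : n \in N -> n ^+ p = 1.
  by case/(abelemP p_pr): abelN => _; apply.
have scalG g n : g \in G -> n \in N -> n ^ g \in <[n]>.
  move=> Gg Nn; have Ng := subsetP nNG g Gg.
  have [m /setD1P[nt_m Nm] [a mg]] := abelem_eigenvector p_pr abelN ntN Ng (cNX g Gg).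
  pose E := [set m in N | m ^ g == m ^+ a].
  have gE : group_set E.
    apply/group_setP; split=> [|x y]; first by rewrite inE group1 conj1g expg1n /=.
    rewrite !inE => /andP[Nx /eqP xg] /andP[Ny /eqP yg].
    by rewrite groupM //= conjMg xg yg expgMn //; apply: (centsP cNN).
  have defE : group gE :=: N.
    apply: minN1 => /=; last by apply/subsetP=> x /setIdP[].
    apply/andP; split.
      by apply/(trivgPn (group gE)); exists m; rewrite //= inE Nm mg eqxx.
    apply/subsetP=> h Gh; have Nh := subsetP nNG h Gh.
    rewrite inE; apply/subsetP=> _ /imsetP[x /setIdP[Nx /eqP xg] ->].
    rewrite inE memJ_norm // Nx -conjXg -xg -!conjgM.
    (* [h, g] centralises N, so conjugation by h preserves the eigenspace E. *)
    rewrite (commgC h g).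
    rewrite (conjgM x (g * h)); apply/eqP/conjg_fixP/commgP.
    have: [~ h, g] \in 'C(N) by rewrite (subsetP cN') // mem_commg.
    move/centP/(_ (x ^ (g * h))) => c; apply/commute_sym/c.
    by rewrite memJ_norm // groupM.
  have: n \in group gE by rewrite defE.
  by case/setIdP=> _ /eqP->; apply: mem_cycle.
have [n Nn nt_n] := trivgPn _ ntN.
have <- : <[n]> = N.
  apply: minN1; last by rewrite cycle_subG.
  rewrite cycle_eq1 nt_n /=; apply/subsetP=> g Gg.
  by rewrite inE -cycleJ cycle_subG scalG.
by rewrite -orderE; apply: nt_prime_order => //; apply: Np.
Qed.

Section FormationExtension.

Variable F : group_class.
Hypotheses (F_formation : formation F) (F_saturated : saturated F).
Hypothesis F_supersolvable : forall (rT : finGroupType) (K : {group rT}),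
  supersolvable K -> F K.

Lemma formation_isog (gT rT : finGroupType) (G : {group gT}) (H : {group rT}) :
  G \isog H -> F G -> F H.
Proof. by case: F_formation => isoF _ _; apply: isoF. Qed.

Lemma formation_quotient (gT : finGroupType) (G N : {group gT}) :
  N <| G -> F G -> F (G / N)%G.
Proof. by case: F_formation => _ quoF _; apply: quoF. Qed.

Lemma formation_quotient1 (gT : finGroupType) (G N : {group gT}) :
  N :=: 1 -> F (G / N)%G <-> F G.
Proof.
move=> N1; have isoG : G \isog (G / N)%G by rewrite /= N1 quotient1_isog.
by split; apply: formation_isog; rewrite // isog_sym.
Qed.

Lemma formation_third (gT : finGroupType) (G H K : {group gT}) :
    H <| G -> K <| G -> H \subset K ->
  F ((G / H) / (K / H))%G <-> F (G / K)%G.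
Proof.
move=> nHG nKG sHK; have isoG := third_isog sHK nHG nKG.
by split; apply: formation_isog; rewrite // isog_sym.
Qed.

(** If N lies in Phi(G), saturation applies. Otherwise N has a complement M
    that is a maximal subgroup, and D = C_M(N) is normal in G. The quotient
    G / D is an extension of N by a subgroup of the cyclic group Aut(N), hence
    supersolvable, and G embeds subdirectly in (G / N) x (G / D). *)
Lemma formation_prime_extension (gT : finGroupType) (G N : {group gT}) :
  N <| G -> prime #|N| -> F (G / N)%G -> F G.
Proof.
move=> nsNG prN FGN; have [sNG nNG] := andP nsNG.
have [sNPhi | nsNPhi] := boolP (N \subset 'Phi(G)).
  apply: F_saturated; apply/(formation_third nsNG (Phi_normal G)) => //.
  by apply: formation_quotient FGN; rewrite quotient_normal // Phi_normal.
have [M maxM nsNM] : exists2 M : {group gT}, maximal M G & ~~ (N \subset M).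
  have /exists_inP[M maxM nsNM] :
      [exists (M : {group gT} | maximal_eq M G), ~~ (N \subset M)].
    by rewrite -negb_forall_in; apply: contra nsNPhi => /forall_inP sN; apply/bigcapsP.
  exists M => //; case/predU1P: maxM => // defM.
  by rewrite defM sNG in nsNM.
have sMG := proper_sub (maxgroupp maxM); have nNM := subset_trans sMG nNG.
have defG : N * M = G.
  rewrite -norm_joinEr //; apply/eqP; rewrite eqEproper join_subG sNG sMG /=.
  apply: contra nsNM => prNM; have [_ maxM1] := maxgroupP maxM.
  by rewrite -(maxM1 _ prNM) ?joing_subl ?joing_subr.
have tiNM : N :&: M = 1 by rewrite prime_TIg.
pose D := 'C_M(N)%G.
have cND : N \subset 'C(D) by rewrite centsC subsetIr.
have nDG : G \subset 'N(D).
  by rewrite -defG mulG_subG cents_norm //= normsI ?normG ?norms_cent.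
have nsDG : D <| G by rewrite /normal nDG subIset ?sMG.
have tiND : (N :&: D)%G :=: 1 by apply/trivgP; rewrite /= -tiNM setIS // subsetIl.
apply/(formation_quotient1 G tiND); case: F_formation => _ _; apply=> //.
apply: F_supersolvable; have nDN := subset_trans sNG nDG.
have sDG := normal_sub nsDG.
exists [:: (N <*> D / D)%G; (G / D)%G] => //=.
have nsNDG : N <*> D <| G by rewrite normalY.
have sND_G := normal_sub nsNDG.
rewrite !quotient_normal ?normalG ?quotientS ?sub1G //=.
have cycN : cyclic N := prime_cyclic prN.
have [_ nNDG] := andP nsNDG.
rewrite quotientYidr // -(isog_cyclic (quotient1_isog _)) quotient_cyclic //=.
rewrite andbT -quotientYidr // (isog_cyclic (third_isog _ nsDG nsNDG)) ?joing_subr //.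
have cNN : N \subset 'C(N) by apply/cyclic_abelian/prime_cyclic.
(* N <*> D is the centraliser of N in G. *)
have defC : N <*> 'C_M(N) = G :&: 'ker (conj_aut N).
  by rewrite ker_conj_aut norm_joinEr ?(subset_trans sDG) //= group_modl // defG.
suffices: cyclic (G / (N <*> 'C_M(N))) by [].
rewrite defC (isog_cyclic (first_isog_loc _ nNG)).
exact: cyclicS (Aut_conj_aut N G) (Aut_prime_cyclic prN).
Qed.
(** Induction on |P|: the hypothesis makes B(G) act as a p-group on a minimal
    normal subgroup N of G inside P, hence trivially, and so |N| = p. *)
Theorem formation_p_extension p (gT : finGroupType) (G P : {group gT}) :
    prime p -> p.-group P -> P <| G ->
    p_residual p (strict_residual p G) \subset 'C(P) ->
  F (G / P)%G -> F G.
Proof.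
move=> p_pr; have [n] := ubnP #|P|; elim: n gT G P => // n IHn gT G P.
rewrite ltnS => leP pP nsPG cRP FGP; have [sPG nPG] := andP nsPG.
have [P1 | ntP] := eqVneq (P : {set gT}) 1.
  by apply/(formation_quotient1 G P1).
have [N minN sNP] : {N : {group gT} | minnormal N G & N \subset P}.
  by apply: mingroup_exists; rewrite ntP.
have [/andP[ntN nNG] minN1] := mingroupP minN.
have nsNG : N <| G by rewrite /normal (subset_trans sNP).
have pN := pgroupS sNP pP.
set B := strict_residual p G in cRP.
have nsBG : B <| G := strict_residual_normal p G.
have [sBG nBG] := andP nsBG.
have cBN : B \subset 'C(N).
  have [S sylS] := Sylow_exists p B; have sSB := pHall_sub sylS.
  have nNS := subset_trans (subset_trans sSB sBG) nNG.
  have pNS : p.-group (N <*> S).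
    by rewrite norm_joinEr // pgroupM pN (pHall_pgroup sylS).
  have nsNS : N <| N <*> S by rewrite /normal joing_subl join_subG normG.
  have /trivgPn[x /setIP[Nx /setIP[_ cx]] nt_x] :=
    meet_center_nil (pgroup_nil pNS) nsNS ntN.
  have defCN : 'C_N(B) = N.
    apply: (minN1 [group of 'C_N(B)]); last exact: subsetIl.
    rewrite /= normsI ?norms_cent // andbT; apply/trivgPn; exists x => //.
    rewrite inE Nx -sub1set centsC (subset_trans (sub_p_residual_Sylow sylS)) //.
    rewrite join_subG (subset_trans cRP) /=; last first.
      by rewrite centS // sub1set (subsetP sNP).
    by rewrite centsC sub1set (subsetP _ _ cx) // centS // joing_subr.
  by rewrite centsC; apply/setIidPl.
have oN := minnormal_prime p_pr pN minN cBN.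
apply: (formation_prime_extension nsNG); first by rewrite oN.
apply: (IHn _ _ (P / N)%G).
- by apply: leq_trans leP; apply: ltn_quotient.
- exact: quotient_pgroup.
- exact: quotient_normal.
- exact: strict_residual_quotient_cent.
by apply/formation_third.
Qed.

End FormationExtension.

(** * The criterion of Frobenius for normal p-complements *)

Section FrobeniusCriterion.
Variables (p : nat) (gT : finGroupType).
Implicit Types G H P Q D S U : {group gT}.

Lemma norm_p_residual_Sylow G S :
  p.-Sylow(G) S -> p_residual p G * S = G.
Proof.
move=> sylS; have sSG := pHall_sub sylS; have sRG := p_residual_sub p G.
rewrite -norm_joinEr; last first.
  by rewrite (subset_trans sSG) // p_residual_norm ?normG.
by apply/eqP; rewrite eqEsubset join_subG sRG sSG sub_p_residual_Sylow.
Qed.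

(** Equivalently, N_H(U) / C_H(U) is a p-group for every p-subgroup U of H. *)
Definition p_local_cent H :=
  forall U, U \subset H -> p.-group U -> p_residual p 'N_H(U) \subset 'C(U).

(** Induction on the index of D = P :&: Q. The normaliser of D contains larger
    parts of P and of Q; in it, Sylow subgroups S and T above these parts are
    conjugate by an element centralising D, since O^p(N_H(D)) does. Going
    through Sylow subgroups of H above S and T splits the problem in two with
    larger intersections. *)
Lemma Sylow_conj_cent_meet H P Q :
    p_local_cent H -> p.-Sylow(H) P -> p.-Sylow(H) Q ->
  exists2 c, c \in 'C_H(P :&: Q) & Q :=: P :^ c.
Proof.
move=> locH; have [n] := ubnP (#|H| - #|P :&: Q|).
elim: n => // n IHn in P Q *; rewrite ltnS => le_n sylP sylQ.
have [sPH pP _] := and3P sylP; have [sQH pQ _] := and3P sylQ.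
set D := P :&: Q in le_n *.
have [sPQ | nsPQ] := boolP (P \subset Q).
  exists 1; rewrite ?group1 // conjsg1; apply/eqP.
  by rewrite eq_sym eqEcard sPQ (card_Hall sylP) (card_Hall sylQ) /=.
have prDP : D \proper P by rewrite /D properE subsetIl subsetI subxx.
have prDQ : D \proper Q.
  rewrite /D properE subsetIr subsetI subxx andbT; apply: contra nsPQ => sQP.
  have/eqP->: Q :==: P by rewrite eqEcard sQP (card_Hall sylP) (card_Hall sylQ) /=.
  by [].
have pD : p.-group D := pgroupS (subsetIl P Q) pP.
have sDH : D \subset H by rewrite subIset ?sPH.
set N := 'N_H(D); have sNH : N \subset H := subsetIl _ _.
have bigN (A : {group gT}) : p.-group A -> A \subset H -> D \proper A ->
    D \proper 'N_A(D) /\ 'N_A(D) \subset N.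
  move=> pA sAH prDA; split; last by rewrite setSI.
  exact: nilpotent_proper_norm (pgroup_nil pA) prDA.
have [prDNP sNPN] := bigN P pP sPH prDP; have [prDNQ sNQN] := bigN Q pQ sQH prDQ.
have [S sylS sNPS] := Sylow_superset sNPN (pgroupS (subsetIl _ _) pP).
have [T sylT sNQT] := Sylow_superset sNQN (pgroupS (subsetIl _ _) pQ).
have [sSN pS _] := and3P sylS; have [sTN pT _] := and3P sylT.
have [x Nx defT] := Sylow_trans sylS sylT.
have cRD : p_residual p N \subset 'C(D) by apply: (locH [group of D]).
have [c Rc defTc] : exists2 c, c \in p_residual p N & T :=: S :^ c.
  move: Nx; rewrite -(norm_p_residual_Sylow sylS).
  have -> : p_residual p N * S = S * p_residual p N.
    by apply/esym/normC; rewrite (subset_trans sSN) // p_residual_norm ?normG.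
  case/mulsgP=> s c Ss Rc defx; exists c => //.
  by rewrite defT defx conjsgM conjGid.
have Hc : c \in H by rewrite (subsetP sNH) // (subsetP (p_residual_sub p _)).
have [R sylR sSR] := Sylow_superset (subset_trans sSN sNH) pS.
have bigger (A : {group gT}) : D \proper A -> A \subset H -> #|H| - #|A| < n.
  move=> prDA sAH; apply: leq_trans le_n.
  have ltDA := proper_card prDA.
  exact: ltn_sub2l (leq_trans ltDA (subset_leq_card sAH)) ltDA.
have prPR : D \proper P :&: R.
  apply: proper_sub_trans prDNP _.
  by rewrite subsetI subsetIl (subset_trans sNPS).
have [a /setIP[Ha Ca] defR] :=
  IHn _ _ (bigger _ prPR (subset_trans (subsetIl _ _) sPH)) sylP sylR.
have sylRc : p.-Sylow(H) (R :^ c)%G by rewrite pHallJ.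
have prRQ : D \proper (R :^ c)%G :&: Q.
  apply: proper_sub_trans prDNQ _.
  by rewrite subsetI subsetIl andbT (subset_trans sNQT) // defTc conjSg.
have [b /setIP[Hb Cb] defQ] :=
  IHn _ _ (bigger _ prRQ (subset_trans (subsetIr _ _) sQH)) sylRc sylQ.
exists (a * c * b); last by rewrite defQ /= defR !conjsgM.
rewrite inE !groupM //=.
- by apply: subsetP Ca; rewrite centS // proper_sub.
- exact: (subsetP cRD).
by apply: subsetP Cb; rewrite centS // proper_sub.
Qed.

(** The Sylow subgroups P^g and P both contain x^g; a conjugation from one to
    the other fixing x^g reduces to the case of g normalising P, where g can
    be taken in P modulo elements that centralise P. *)
Lemma Sylow_fusion H P x g :
    p_local_cent H -> p.-Sylow(H) P -> g \in H -> x \in P -> x ^ g \in P ->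
  exists2 u, u \in P & x ^ g = x ^ u.
Proof.
move=> locH sylP Hg Px Pxg; have [sPH pP _] := and3P sylP.
have sylPg : p.-Sylow(H) (P :^ g)%G by rewrite pHallJ.
have [c /setIP[Hc Cc] defP] := Sylow_conj_cent_meet locH sylPg sylP.
have Ngc : g * c \in 'N_H(P).
  by rewrite inE groupM //=; apply/normP; rewrite conjsgM -defP.
have sylPN : p.-Sylow('N_H(P)) P.
  by apply: pHall_subl sylP; rewrite ?subsetI ?sPH ?normG ?subsetIl.
move: Ngc; rewrite -(norm_p_residual_Sylow sylPN) => /mulsgP[r u Rr Pu defgc].
exists u => //.
have <- : (x ^ g) ^ c = x ^ g.
  by apply/conjg_fixP/commgP/commute_sym/(centP Cc); rewrite inE memJ_conjg Px.
rewrite -conjgM defgc conjgM; congr (_ ^ _).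
apply/conjg_fixP/commgP/commute_sym/(centsP (locH P sPH pP)) => //.
Qed.

(** Transfer into the abelian group P / P'. For x in P, each factor in the
    expansion of the transfer of x is conjugate in H, hence in P, to a power
    of x; so the transfer of x is the class of x^m with m = |H : P| prime to p.
    The kernel therefore meets P inside P', and it contains all p'-elements. *)
Lemma p_residual_proper_of_fusion H P :
    p.-Sylow(H) P -> P :!=: 1 ->
    (forall x g, g \in H -> x \in P -> x ^ g \in P ->
       exists2 u, u \in P & x ^ g = x ^ u) ->
  exists2 K : {group gT}, p_residual p H \subset K & K \proper H.
Proof.
move=> sylP ntP fusP; have [sPH pP _] := and3P sylP.
pose alpha := restrm_morphism (der_norm 1 P) (coset_morphism P^`(1)).
have imA : alpha @* P = P / P^`(1) by rewrite morphim_restrm setIid.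
have abelA : abelian (alpha @* P) by rewrite imA sub_der1_abelian.
pose V := transfer_morphism H abelA.
pose fv (u : FiniteModule.fmod_of abelA) := FiniteModule.fmval u.
have fmX u k : fv (u ^+ k) = (fv u) ^+ k.
  by apply: (morphX (FiniteModule.fmval_morphism abelA)); rewrite inE.
have pV u : p.-elt (fv u).
  have: fv u \in P / P^`(1) by rewrite -imA; apply: FiniteModule.fmodP.
  by apply: mem_p_elt; rewrite quotient_pgroup.
exists [group of 'ker V]; last first.
  rewrite properE subsetIl /=; apply/negP=> sHK.
  have: ~~ (P \subset P^`(1)).
    have := sol_der1_proper (pgroup_sol pP) (subxx _) ntP.
    by rewrite properE => /andP[].
  case/negP; apply/subsetP=> x Px; have Hx := subsetP sPH x Px.
  pose HPx := rcosets P H :* <[x]>; pose X := transversal HPx H.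
  have trX : is_transversal X HPx H by apply/transversalP/rcosets_cycle_partition.
  have Nx : x \in 'N(P^`(1)) by apply: (subsetP (der_norm 1 P)).
  have cosetJ w u : w \in P -> u \in P -> coset P^`(1) (w ^ u) = coset P^`(1) w.
    move=> Pw Pu; rewrite conjg_mulR morphM ?(subsetP (der_norm 1 P)) ?groupR //=.
    by rewrite (coset_id (x := [~ w, u])) ?mulg1 // mem_commg.
  pose f := FiniteModule.fmod abelA (alpha x).
  have /esym/(congr1 fv) : V x = (f *+ #|H : P|)%R.
    rewrite [V x](transfer_cycle_expansion sPH abelA Hx trX).
    rewrite -(sum_index_rcosets_cycle sPH Hx trX).
    rewrite -[RHS]GRing.sumrMnr; apply: eq_bigr => y Xy.
    have Hy : y \in H by apply: (subsetP (transversal_sub trX)).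
    set k := #|_ : _|; rewrite -FiniteModule.fmodX ?mem_morphim //=.
    have Pxk : (x ^+ k) ^ y^-1 \in P.
      by rewrite conjgE invgK mulgA -mem_rcoset mulg_exp_card_rcosets.
    have [u Pu defxk] := fusP _ _ (groupVr Hy) (groupX k Px) Pxk.
    rewrite /restrm /= defxk; congr (FiniteModule.fmod _ _).
    by rewrite -morphX //= cosetJ // groupX.
  have /mker-> : x \in 'ker V by apply: (subsetP sHK).
  rewrite -FiniteModule.fmodX ?mem_morphim // /fv FiniteModule.fmodK;
    last by rewrite groupX ?mem_morphim.
  move=> /= fx1; apply: coset_idr => //; apply/eqP.
  rewrite -order_eq1 (@pnat_1 p #[_]) //; first exact: morph_p_elt (mem_p_elt pP Px).
  have p'HP : p^'.-nat #|H : P| by case/and3P: sylP.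
  by apply: pnat_dvd p'HP; rewrite order_dvdn; apply/eqP.
apply/p_residual_subP=> z Hz p'z; apply/kerP=> //.
apply: val_inj; apply/eqP; rewrite -[_ == _]/(fv (V z) == 1) -order_eq1.
rewrite (@pnat_1 p #[_]) //; first exact: pV.
apply: pnat_dvd p'z; rewrite order_dvdn -fmX -morphX // expg_order morph1.
exact/eqP.
Qed.

(** A group has a normal p-complement exactly when the subgroup generated by its
    p'-elements is a p'-group. Induction through the kernel of the transfer,
    which has the same p'-elements. *)
Theorem Frobenius_p_residual H :
  p_local_cent H -> p^'.-group (p_residual p H).
Proof.
have [n] := ubnP #|H|; elim: n H => // n IHn H; rewrite ltnS => leHn locH.
have [P sylP] := Sylow_exists p H.
have [P1 | ntP] := eqVneq (P : {set gT}) 1.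
  apply: pgroupS (p_residual_sub p H) _.
  by rewrite -partG_eq1 -(card_Hall sylP) P1 cards1.
have [K sRK prKH] :=
  p_residual_proper_of_fusion sylP ntP (fun x g => Sylow_fusion locH sylP).
have sKH := proper_sub prKH.
apply: (@pgroupS _ _ (p_residual p K)).
  apply/p_residual_subP=> z Hz p'z.
  by rewrite mem_p_residual // (subsetP sRK) // mem_p_residual.
apply: IHn; first exact: leq_trans (proper_card prKH) leHn.
move=> U sUK pU; apply: subset_trans (locH U (subset_trans sUK sKH) pU).
apply/p_residual_subP=> z /setIP[Kz Nz] p'z.
by rewrite mem_p_residual // inE Nz (subsetP sKH).
Qed.

End FrobeniusCriterion.

(** * Weakly embedded cyclic subgroups *)

Section Embedding.
Variables (p : nat) (gT : finGroupType).
Implicit Types (x y : gT) (G K L P Q S U H N T : {group gT}).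
Hypothesis p_pr : prime p.

Lemma p_residual_sub_primes G N :
    (forall q y, prime q -> q != p -> y \in G -> q.-elt y -> y \in N) ->
  p_residual p G \subset N.
Proof.
move=> qN; apply/p_residual_subP=> z Gz p'z.
rewrite -(prod_constt z); apply: group_prod => q _.
have [-> | ne_qp] := eqVneq q p; first by move/constt1P: p'z => ->.
have [q_pr | q'] := boolP (prime q); last first.
  suffices/eqP->: z.`_q == 1 by apply: group1.
  by rewrite -order_eq1 order_constt p_part lognE (negPf q').
apply: (qN q); rewrite ?p_elt_constt // (subsetP _ _ (cycle_constt _ _)) //.
by rewrite cycle_subG.
Qed.

Lemma mem_Sylow (q : nat) G y :
  y \in G -> q.-elt y -> exists2 Q : {group gT}, q.-Sylow(G) Q & y \in Q.
Proof.
rewrite -cycle_subG => sYG qy; have [Q sylQ sYQ] := Sylow_superset sYG qy.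
by exists Q; rewrite // -cycle_subG.
Qed.

(** Modulo K the p-group L permutes with all Sylow p-subgroups, so it lies in
    each of them and in O_p(G / K). For a Sylow q-subgroup Q containing y, the
    image of L is the intersection of the group LQ with O_p(G / K), hence it
    is normalised by y. *)
Lemma s_quasinormal_mul_norm G K L q y :
    K <| G -> L \subset G -> p.-group L -> s_quasinormal G (L * K) ->
    prime q -> q != p -> y \in G -> q.-elt y ->
  y \in 'N(L * K).
Proof.
move=> nsKG sLG pL /s_quasinormalP sqLK q_pr ne_qp Gy qy.
have [sKG nKG] := andP nsKG; have nKL := subset_trans sLG nKG.
have comm r Q : prime r -> r.-Sylow(G) Q -> commute (L / K) (Q / K).
  move=> r_pr sylQ; have nKQ := subset_trans (pHall_sub sylQ) nKG.
  have nKLK : L * K \subset 'N(K) by rewrite mul_subG ?normG.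
  rewrite /commute -(quotientMidr K L) -(quotientMl Q nKLK) (sqLK r Q r_pr sylQ).
  by rewrite (quotientMl _ nKQ).
have pLK : p.-group (L / K) by rewrite quotient_pgroup.
have sLO : L / K \subset 'O_p(G / K).
  apply/bigcapsP=> M; rewrite max_pgroup_Sylow => sylM.
  have [P sylP] := Sylow_exists p G.
  have sylPK := quotient_pHall (subset_trans (pHall_sub sylP) nKG) sylP.
  have [_ /morphimP[g Ng Gg ->] defM] := Sylow_trans sylPK sylM.
  have sylPg : p.-Sylow(G) (P :^ g)%G by rewrite pHallJ.
  have sylPgK := quotient_pHall (subset_trans (pHall_sub sylPg) nKG) sylPg.
  have -> : M :=: (P :^ g)%G / K by rewrite defM /= quotientJ.
  apply: (comm_sub_max_pgroup (G := G / K) (pi := p)) => //.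
  - by rewrite max_pgroup_Sylow.
  - exact: quotientS.
  exact: comm p_pr sylPg.
have [Q sylQ Qy] : exists2 Q : {group gT}, q.-Sylow(G) Q & y \in Q.
  exact: mem_Sylow.
have NKy := subsetP nKG y Gy.
have tiQO : Q / K :&: 'O_p(G / K) = 1.
  have pO := pcore_pgroup p (G / K).
  rewrite coprime_TIg // (@pnat_coprime q) //.
    exact: quotient_pgroup (pHall_pgroup sylQ).
  by apply: sub_in_pnat pO => r _ /eqP->; rewrite !inE eq_sym.
have gLQ : group_set (L / K * (Q / K)) by apply/comm_group_setP/(comm q).
have sLJ : (L / K) :^ coset K y \subset L / K.
  have Ky : coset K y \in Q / K by rewrite mem_quotient.
  have sLJ_LQ : (L / K) :^ coset K y \subset group gLQ.
    rewrite -(conjGid (subsetP (mulG_subr _ _) _ Ky : coset K y \in group gLQ)).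
    by rewrite conjSg mulG_subl.
  have sLJ_O : (L / K) :^ coset K y \subset 'O_p(G / K).
    have nO := normal_norm (pcore_normal p (G / K)).
    by rewrite -(normsP nO (coset K y)) ?conjSg ?mem_quotient.
  have defLK : L / K * (Q / K) :&: 'O_p(G / K) = L / K.
    by rewrite -group_modl // tiQO mulg1.
  apply: (@subset_trans _ _ (L / K * (Q / K) :&: 'O_p(G / K))); last by rewrite defLK.
  by rewrite subsetI; apply/andP.
have nsKLK : K <| L <*> K by rewrite /normal joing_subr join_subG nKL normG.
have nsKN : K <| 'N_G(L <*> K).
  rewrite /normal subsetI sKG subIset ?nKG // andbT.
  by rewrite (subset_trans (joing_subr L K)) ?normG.
rewrite -norm_joinEl //.
suffices: y \in 'N_G(L <*> K) by case/setIP.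
rewrite -(quotientGK nsKN) mem_morphpre // quotient_subnormG //.
by rewrite quotientYidr // inE mem_quotient // inE.
Qed.

(** L is still a Sylow p-subgroup of the group SQ, so that L is the intersection
    of U with SQ, and y normalises both. *)
Lemma Sylow_permute_norm L S Q U q y :
    prime q -> q != p -> q.-group Q -> p.-group U -> L \subset U ->
    p.-Sylow(S) L -> commute S Q -> y \in Q -> y \in 'N(U) ->
  y \in 'N(L).
Proof.
move=> q_pr ne_qp qQ pU sLU sylL cSQ Qy Uy.
have [sLS pL _] := and3P sylL.
have gM : group_set (S * Q) by apply/comm_group_setP.
pose M := group gM.
have p'Q : p^'.-group Q.
  by apply: sub_in_pnat qQ => r _ /eqP->; rewrite !inE.
have sylLM : p.-Sylow(M) L.
  rewrite pHallE (subset_trans sLS) ?mulG_subl //= (card_Hall sylL).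
  have /(congr1 (fun n : nat => n`_p)%N) :
    (#|S| * #|Q| = #|M| * #|S :&: Q|)%N := mul_cardG S Q.
  rewrite !partnM ?cardG_gt0 // (part_p'nat p'Q).
  by rewrite (part_p'nat (pgroupS (subsetIr S Q) p'Q)) !muln1 => ->.
have <- : U :&: M = L.
  apply: (sub_pHall sylLM); rewrite ?subsetIr ?(pgroupS (subsetIl _ _)) //.
  by rewrite subsetI sLU (pHall_sub sylLM).
rewrite -sub1set normsI ?sub1set // (subsetP (normG M)) //.
by rewrite (subsetP (mulG_subr S Q)).
Qed.

(** The proper subgroups of a cyclic p-group all lie in its subgroup of index p,
    so they cannot generate it. *)
Lemma cycle_sub_gen_bigcup x (D : pred {group gT}) :
    p.-elt x -> x != 1 ->
    <[x]> \subset <<\bigcup_(K : {group gT} | (K \subset <[x]>) && D K) K>> ->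
  D <[x]>%G.
Proof.
move=> px nt_x; apply: contraTT => ncyc.
have ntX : <[x]> != 1 by rewrite cycle_eq1.
have [_ dv_px _] := pgroup_pdiv px ntX.
have ltx : <[x ^+ p]> \proper <[x]>.
  rewrite properEcard cycle_subG mem_cycle /= -!orderE orderXdiv //.
  by rewrite ltn_Pdiv ?prime_gt1 ?order_gt0.
apply/negP=> sx; have := proper_subn ltx; case/negP; apply: subset_trans sx _.
rewrite gen_subG; apply/bigcupsP=> K /andP[sKx DK]; apply/subsetP=> k Kk.
have /cycleP[i defk] := subsetP sKx k Kk.
have [/dvdnP[j defi] | p'i] := boolP (p %| i).
  by rewrite defk defi mulnC expgM mem_cycle.
case/negP: ncyc; suffices <-: K = <[x]>%G by [].
apply/val_inj/eqP; rewrite /= eqEsubset sKx /=.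
have /eqP-> : <[x]> == <[x ^+ i]>.
  rewrite -[_ == _]/(generator _ _) generator_coprime.
  by rewrite (@pnat_coprime p) // ?p'natE.
by rewrite cycle_subG -defk.
Qed.

Lemma s_quasinormally_embedded_norm G L U q y :
    p.-group U -> L \subset U -> L :!=: 1 -> s_quasinormally_embedded G L ->
    prime q -> q != p -> y \in 'N_G(U) -> q.-elt y ->
  y \in 'N(L).
Proof.
move=> pU sLU ntL /forall_inP seL q_pr ne_qp /setIP[Gy Uy] qy.
have pL := pgroupS sLU pU.
have sylLL : Sylow L L.
  by apply: (@p_Sylow _ p); rewrite pHallE subxx /= part_pnat_id.
have /existsP[S /and3P[_ /s_quasinormalP sqS sylL]] := seL L sylLL.
have [Q sylQ Qy] := mem_Sylow Gy qy.
have sylSL : p.-Sylow(S) L.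
  have [_ dv_pL _] := pgroup_pdiv pL ntL.
  case/SylowP: sylL => r r_pr sylL; have /pgroupP/(_ p p_pr dv_pL) := pHall_pgroup sylL.
  by rewrite inE => /eqP->.
have cSQ := sqS q Q q_pr sylQ.
exact: (Sylow_permute_norm q_pr ne_qp (pHall_pgroup sylQ) pU sLU sylSL cSQ Qy).
Qed.

(** An element y that does not centralise U has a nontrivial commutator with an
    element of U. This commutator lies in U and in the normal closure of any
    Sylow q-subgroup containing y, so that p divides the order of this closure
    and the permutability condition applies. *)
Lemma tau_quasinormal_norm G L U q y :
    p.-group U -> U \subset G -> L \subset U -> L :!=: 1 -> tau_quasinormal G L ->
    prime q -> q != p -> y \in 'N_G(U) -> q.-elt y ->
  y \in 'N(L).
Proof.
move=> pU sUG sLU ntL /tau_quasinormalP tauL q_pr ne_qp /setIP[Gy Uy] qy.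
have pL := pgroupS sLU pU; have [_ dv_pL [k oL]] := pgroup_pdiv pL ntL.
have [cUy | ncUy] := boolP (y \in 'C(U)).
  by rewrite (subsetP (cent_sub L)) // (subsetP (centS sLU)).
have [Q sylQ Qy] := mem_Sylow Gy qy.
have coqL : coprime q #|L|.
  by rewrite oL coprimeXr // prime_coprime // dvdn_prime2.
have sylLL : p.-Sylow(L) L by rewrite pHallE subxx /= part_pnat_id.
apply: (Sylow_permute_norm q_pr ne_qp (pHall_pgroup sylQ) pU sLU sylLL _ Qy Uy).
apply: (tauL q Q) => //.
have [u Uu ncu] : exists2 u, u \in U & [~ u, y] != 1.
  apply/exists_inP; apply: contraR ncUy; rewrite negb_exists_in => /forall_inP cu.
  by apply/centP=> u Uu; apply/commute_sym/commgP; have := cu u Uu; rewrite negbK.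
have closQ : [~ u, y] \in normal_closure Q G.
  have closJ z v : z \in Q -> v \in G -> z ^ v \in <<class_support Q G>>.
    by move=> Qz Gv; apply/mem_gen/imset2P; exists z v.
  have yJ : y \in <<class_support Q G>>.
    by have := closJ _ _ Qy (group1 G); rewrite conjg1.
  have VyJ := closJ _ _ (groupVr Qy) (subsetP sUG u Uu).
  by rewrite /normal_closure commgEr groupM.
have Uc : [~ u, y] \in U by rewrite commgEl groupM ?groupV // memJ_norm.
move=> gcd1; have: p %| 1; last by rewrite Euclid_dvd1.
rewrite -gcd1 dvdn_gcd dv_pL /=.
have ntc : <[ [~ u, y] ]> != 1 by rewrite cycle_eq1.
have [_ dv_pc _] := pgroup_pdiv (mem_p_elt pU Uc) ntc.
apply: dvdn_trans dv_pc _.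
by apply: cardSg; rewrite cycle_subG.
Qed.

(** If x is not in the normal subgroup K of the weak embedding, then R = K.
    Otherwise <x> is itself S-quasinormally embedded or tau-quasinormal, and
    R = 1. *)
Lemma triangle_res_stable G U H x :
    p.-group U -> U \subset G -> H \subset 'N_G(U) -> x \in U -> x != 1 ->
    satisfies_triangle G <[x]>%G ->
  res_stable p H x.
Proof.
move=> pU sUG sHN Ux nt_x tri.
have [sHG nUH] := subsetIP sHN; have px := mem_p_elt pU Ux.
have sxU : <[x]> \subset U by rewrite cycle_subG.
have ntX : <[x]> != 1 by rewrite cycle_eq1.
have stab1 :
  (forall q y, prime q -> q != p -> y \in 'N_G(U) -> q.-elt y ->
     y \in 'N(<[x]>)) ->
  res_stable p H x.
  move=> nX; exists 1%G; split; rewrite ?norms1 // ?inE // mulg1.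
  apply: (p_residual_sub_primes (N := 'N(<[x]>))) => q y q_pr ne_qp Hy.
  by apply: nX => //; apply: (subsetP sHN).
have stabK (K : {group gT}) :
    K <| G -> s_quasinormal G (<[x]> * K) -> x \notin K ->
  res_stable p H x.
  move=> nsKG sqK K'x; exists K; split=> //.
    exact: subset_trans (normal_norm nsKG).
  have nKx : <[x]> \subset 'N(K).
    by rewrite (subset_trans sxU) // (subset_trans sUG) // normal_norm.
  rewrite -norm_joinEl //.
  apply: (p_residual_sub_primes (N := 'N(<[x]> <*> K))) => q y q_pr ne_qp Hy qy.
  rewrite /= norm_joinEl //.
  have sxG := subset_trans sxU sUG; have Gy := subsetP sHG y Hy.
  exact: (s_quasinormal_mul_norm nsKG sxG px sqK q_pr ne_qp Gy qy).
case: tri => [] [K [nsKG sqK]];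
  have [Kx|K'x _] := boolP (x \in K); try exact: (stabK K).
- move=> sIc; apply: stab1 => q y.
  apply: (s_quasinormally_embedded_norm (L := <[x]>%G) pU sxU ntX).
  apply: (cycle_sub_gen_bigcup (D := s_quasinormally_embedded G) px nt_x).
  have sXK : <[x]> \subset K by rewrite cycle_subG.
  by move: sIc; rewrite /= (setIidPl sXK).
- move=> sIc; apply: stab1 => q y.
  apply: (tau_quasinormal_norm (L := <[x]>%G) pU sUG sxU ntX).
  apply: (cycle_sub_gen_bigcup (D := tau_quasinormal G) px nt_x).
  have sXK : <[x]> \subset K by rewrite cycle_subG.
  by move: sIc; rewrite /= (setIidPl sXK).
Qed.

End Embedding.

(** * Hypercentral, cyclic and supersolvable cases *)

Section Stable.
Variables (p : nat) (gT : finGroupType).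
Implicit Types (x y z w : gT) (G K L P Q S U V H N T D : {group gT}).

Lemma res_stable_norm G x :
  x != 1 -> p_residual p G \subset 'N(<[x]>) -> res_stable p G x.
Proof. by move=> nt_x nxG; exists 1%G; rewrite norms1 inE mulg1. Qed.

(** Commutators with z move a p-element down the upper central series while
    staying in the normal p-subgroup O_p of the hypercenter; coprime action
    brings the trivial action back up the series. *)
Lemma hypercenter_cent G x :
  p.-elt x -> x \in hypercenter G -> p_residual p G \subset 'C[x].
Proof.
rewrite /hypercenter; set m := #|G| => px Zx.
pose S := 'O_p('Z_m(G)).
have nilZ : nilpotent 'Z_m(G) := ucn_nilpotent m G.
have Sx : x \in S.
  by rewrite (mem_normal_Hall (nilpotent_pcore_Hall p nilZ)) ?pcore_normal.
have pS : p.-group S := pcore_pgroup p _.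
have nSG : G \subset 'N(S) by apply: char_norm_trans (pcore_char p _) (ucn_norm m G).
apply/p_residual_subP=> z Gz p'z.
have cSz n w : w \in S -> w \in 'Z_n(G) -> commute w z.
  elim: n w => [w _|n IHn w Sw Zw].
    by rewrite ucn0 => /set1P->; apply/commute_sym/commute1.
  have Swz : [~ w, z] \in S.
    by rewrite commgEl groupM ?groupV // memJ_norm // (subsetP nSG).
  apply: coprime_commute.
    by apply: IHn => //; rewrite (subsetP (ucn_comm n G)) // mem_commg.
  exact: pnat_coprime (mem_p_elt pS Swz) p'z.
by apply/cent1P/commute_sym; apply: (cSz m).
Qed.

Lemma cyclic_res_stable G U x :
  cyclic U -> G \subset 'N(U) -> x \in U -> x != 1 -> res_stable p G x.
Proof.
move=> cycU nUG Ux nt_x; apply: res_stable_norm => //.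
apply: subset_trans (p_residual_sub p G) _.
by apply: char_norm_trans nUG; rewrite sub_cyclic_char // cycle_subG.
Qed.

(** In the series U_i N obtained from a normal series of T with cyclic factors,
    the term R just below the first one that contains x works, because a
    subgroup of the cyclic normal factor above R is characteristic in it. *)
Lemma supersolvable_res_stable G N T x :
    supersolvable T -> T \subset 'N(N) -> G \subset N <*> T ->
    x \in N <*> T -> x \notin N ->
  res_stable p G x.
Proof.
move=> [s path_s defT] nNT sGNT NTx N'x.
have: x \in N <*> last 1%G s by rewrite defT.
have: x \notin N <*> (1%G : {group gT}) by rewrite joingG1.
have: (1%G : {group gT}) <| T by exact: normal1.
elim: s 1%G path_s {defT} => [|V s IHs] U /=; first by move=> _ _ /negPf->.
case/andP=> /and3P[nsVT sUV cycVU] path_s nsUT U'x Lx.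
have [Vx|V'x] := boolP (x \in N <*> V); last exact: (IHs V).
have [[sUT nUT] [sVT nVT]] := (andP nsUT, andP nsVT).
pose R := (N <*> U)%G; pose M := (N <*> V)%G; pose A := (N <*> T)%G.
have nsRA : R <| A.
  rewrite /normal join_subG joing_subl (subset_trans sUT) ?joing_subr //=.
  by rewrite join_subG (subset_trans (joing_subl N U)) ?normG // normsY.
have nsMA : M <| A.
  rewrite /normal join_subG joing_subl (subset_trans sVT) ?joing_subr //=.
  by rewrite join_subG (subset_trans (joing_subl N V)) ?normG // normsY.
have [[sRA nRA] [sMA nMA]] := (andP nsRA, andP nsMA).
have nRV : V \subset 'N(R).
  by rewrite (subset_trans _ nRA) // (subset_trans sVT) ?joing_subr.
have cycM : cyclic (M / R).
  have sNR : N \subset R by apply: joing_subl.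
  have -> : M / R = V / R.
    by rewrite /M /= quotientY ?(subset_trans sNR) ?normG // quotientS1 // joing1G.
  have nsIV : R :&: V <| V by rewrite /normal subsetIr normsI ?normG.
  have sUI : U \subset R :&: V by rewrite subsetI sUV joing_subr.
  rewrite -(isog_cyclic (second_isog nRV)).
  rewrite -(isog_cyclic (third_isog sUI (normalS sUV sVT nsUT) nsIV)).
  exact: quotient_cyclic.
have nRx : <[x]> \subset 'N(R) by rewrite cycle_subG (subsetP nRA).
exists R; split=> //; first exact: subset_trans nRA.
rewrite -norm_joinEl // (subset_trans (p_residual_sub _ _)) // (subset_trans sGNT) //.
have nsRX : R <| <[x]> <*> R by rewrite /normal joing_subr join_subG nRx normG.
suffices: <[x]> <*> R <| A by case/andP.
rewrite -(quotientGK nsRX) -(quotientGK nsRA) cosetpre_normal.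
apply: char_normal_trans (quotient_normal _ nsMA).
rewrite sub_cyclic_char // quotientS // join_subG cycle_subG Vx /=.
by rewrite join_subG joing_subl (subset_trans sUV) ?joing_subr.
Qed.

(** A maximal T-invariant proper subgroup E of P above D is normal in P, since
    its normaliser in P is T-invariant and strictly larger. As <x>D = P, this E
    avoids x and satisfies <x>E = P. *)
Lemma p_supplement_res_stable G P D T x :
    p.-group P -> T \subset 'N(P) -> T \subset 'N(D) -> D \proper P ->
    <[x]> * D = P -> G \subset P <*> T ->
  res_stable p G x.
Proof.
move=> pP nPT nDT prDP defP sGPT.
pose good := [pred E : {group gT} | (E \proper P) && (T \subset 'N(E))].
have [|E /maxgroupP[/andP[prEP nET] maxE] sDE] := @maxgroup_exists _ good D.
  by rewrite /good /= prDP.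
have sEP := proper_sub prEP.
have defN : 'N_P(E) = P.
  have prN := nilpotent_proper_norm (pgroup_nil pP) prEP.
  apply/eqP; apply: contraLR prN => neN; rewrite properE negb_and.
  rewrite (maxE [group of 'N_P(E)]) ?subxx ?orbT //=.
    by rewrite properEneq neN subsetIl normsI // norms_norm.
  by rewrite subsetI sEP normG.
have nEP : P \subset 'N(E) by apply/setIidPl.
have nEG : G \subset 'N(E) by rewrite (subset_trans sGPT) // join_subG nEP.
exists E; split=> //.
  apply: contraL prEP => Ex; rewrite properE negb_and negbK -defP.
  by rewrite mul_subG ?orbT // cycle_subG.
have -> : <[x]> * E = P.
  apply/eqP; rewrite eqEsubset -{2}defP mulgS // andbT.
  by rewrite mul_subG // -defP mulG_subl.
rewrite (subset_trans (p_residual_sub _ _)) // (subset_trans sGPT) //.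
by rewrite join_subG normG.
Qed.

End Stable.

(** * Subgroups of small index and the derived subgroup *)

Section Supplement.
Variables (gT : finGroupType).
Implicit Types (x y z w : gT) (G H X : {group gT}).

(** A subgroup X whose index is the smallest prime divisor p of |H| is normal:
    if X is not contained in its conjugate Y, then |X : X :&: Y| is at least p,
    so that XY = H, and this forces the conjugating element into X. *)
Lemma der1_index_pdiv H X : X \subset H -> #|H : X| = pdiv #|H| -> H^`(1) \subset X.
Proof.
move=> sXH iX; have [H1 | ntH] := eqVneq (H : {set gT}) 1.
  by rewrite (subset_trans (der_sub 1 H)) // H1 sub1G.
have p_pr : prime (pdiv #|H|) by rewrite pdiv_prime ?cardG_gt1.
have nXH : H \subset 'N(X).
  apply/subsetP=> h Hh; rewrite inE; pose Y := (X :^ h)%G.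
  have sYH : Y \subset H by rewrite -(conjGid Hh) conjSg.
  have [sXY | nsXY] := boolP (X \subset Y).
    have := subset_leqif_cards sXY; rewrite cardJg => -[_].
    by rewrite eqxx => /esym/eqP {2}->.
  have le_pk : pdiv #|H| <= #|X : X :&: Y|.
    apply: pdiv_min_dvd; last exact: dvdn_trans (dvdn_indexg _ _) (cardSg sXH).
    rewrite ltn_neqAle indexg_gt0 andbT eq_sym indexg_eq1.
    by rewrite subsetI subxx.
  have defXY : X * Y = H.
    apply/eqP; rewrite eqEcard mul_subG //= -(leq_pmul2r (cardG_gt0 (X :&: Y))).
    rewrite -mul_cardG cardJg -(Lagrange sXH) iX -mulnA leq_mul2l.
    by rewrite -{2}(Lagrange (subsetIl X Y)) mulnC leq_mul2l le_pk !orbT.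
  move: Hh; rewrite -{1}defXY => /mulsgP[a _ Xa /imsetP[b Xb ->] defh].
  have Xh : h \in X.
    have -> : h = b * a; last exact: groupM.
    have: a * h^-1 * b = 1 by apply: (mulIg h); rewrite mul1g [RHS]defh conjgE !mulgA.
    move/(canRL (mulgK b)); rewrite mul1g => /(canRL (mulKg a)).
    by move/(congr1 invg); rewrite invgK invMg !invgK.
  by rewrite conjGid.
rewrite der1_min // cyclic_abelian // prime_cyclic // card_quotient // iX //.
Qed.

(** The generator x permutes the cosets of X in a single cycle of even length,
    an odd permutation, whereas the derived subgroup acts by even ones. *)
Lemma der1_even_index H X x :
  <[x]> * X = H -> ~~ odd #|H : X| -> x \notin H^`(1).
Proof.
move=> defH even_i; pose S := rcosets X H.
have sXH : X \subset H by rewrite -defH mulG_subr.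
have Hx : x \in H by rewrite -cycle_subG -defH mulG_subl.
have nSH : [acts H, on S | 'Rs] := actsRs_rcosets X H.
(* The action is extended to all subsets of the group by fixing those that are
   not cosets of X; each of these adds one cycle and one point. *)
pose f := actperm <[nSH]>.
have even_f : f @* H^`(1) \subset 'Alt_{set gT}.
  rewrite morphim_der ?gen_subG //.
  apply/subsetP=> _ /imset2P[s t _ _ ->].
  by rewrite Alt_even /= commgEl odd_permM odd_permV odd_permJ addbb.
apply/negP=> H'x; have: f x \in 'Alt_{set gT}.
  by rewrite (subsetP even_f) // mem_morphim.
rewrite Alt_even => /negP[].
have defH' : X * <[x]> = H.
  have/comm_group_setP <- : group_set (<[x]> * X) by rewrite defH groupP.
  by [].
have sxH : <[x]> \subset H by rewrite cycle_subG.
have defS A : A \in S -> exists2 u, u \in <[x]> & A = X :* u.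
  case/rcosetsP=> h; rewrite -defH' => /mulsgP[a u Xa xu ->] ->.
  by exists u; rewrite // rcosetM rcoset_id.
have orbS A : A \in S -> porbit (f x) A = S.
  move=> SA; rewrite porbit_actperm //; have [u xu defA] := defS A SA.
  apply/eqP; rewrite eqEsubset; apply/andP; split.
    apply/subsetP=> _ /orbitP[v xv <-]; have Hv := subsetP sxH v xv.
    by rewrite /= actbyE // (acts_act nSH).
  apply/subsetP=> B /defS[v xv ->]; apply/orbitP; exists (u^-1 * v).
    by rewrite groupM ?groupV.
  by rewrite /= actbyE ?(subsetP sxH) ?groupM ?groupV //= defA rcosetE -rcosetM mulKVg.
have orbS' A : A \notin S -> porbit (f x) A = [set A].
  move=> S'A; rewrite porbit_actperm //; apply/eqP.
  rewrite eqEsubset sub1set orbit_refl andbT.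
  by apply/subsetP=> _ /orbitP[v xv <-]; rewrite /= /actby (negPf S'A) inE.
have S_X : gval X \in S by apply/rcosetsP; exists 1; rewrite ?rcoset1.
have defO : porbits (f x) = S |: [set [set A] | A in ~: S].
  apply/setP=> O; rewrite !inE; apply/imsetP/orP=> [[A _ ->] | [/eqP-> | /imsetP[A]]].
  - have [SA | S'A] := boolP (A \in S); first by left; rewrite orbS.
    by right; rewrite orbS' // imset_f // inE.
  - by exists (gval X); rewrite ?orbS.
  by rewrite inE => S'A ->; exists A; rewrite ?orbS'.
have oO : #|porbits (f x)| = #|~: S|.+1.
  rewrite defO cardsU1 card_imset; last exact: set1_inj.
  suffices -> : S \notin [set [set A] | A in ~: S] by [].
  apply/imsetP=> [[A]]; rewrite inE => /negP nSA defSA; apply: nSA.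
  by rewrite defSA set11.
by rewrite /odd_perm oO -(cardsC S) oddD (negPf even_i) /= addbN addbb.
Qed.

End Supplement.

(** * From the embedding hypothesis to the formation *)

Section Main.
Variable gT : finGroupType.
Implicit Types (x y z : gT) (D G H K L P T U X : {group gT}) (p : nat).

(** Elements of the derived subgroup cannot have a proper supplement here: for
    x of order p, the index of X would be the smallest prime p, and for p = 2
    it would be even. *)
Lemma smallest_prime_supplement H X x :
    (pdiv #|H|).-elt x -> #[x] = pdiv #|H| \/ pdiv #|H| = 2 ->
    x \in H^`(1) -> <[x]> * X = H -> x \in X.
Proof.
set p := pdiv #|H| => px ox H'x defH; apply: contraLR H'x => X'x.
have sXH : X \subset H by rewrite -defH mulG_subr.
have iX : #|H : X| = #|<[x]> : <[x]> :&: X|.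
  apply/eqP; rewrite -(eqn_pmul2r (cardG_gt0 X)) mulnC Lagrange // -defH.
  rewrite -(eqn_pmul2r (cardG_gt0 (<[x]> :&: X))) -mul_cardG mulnAC.
  by rewrite -{1}(Lagrange (subsetIl <[x]> X)) [(#|_ :&: _| * _)%N]mulnC.
have p_pr : prime p.
  rewrite pdiv_prime // (leq_trans _ (subset_leq_card (_ : <[x]> \subset H))) //.
    by rewrite cardG_gt1 cycle_eq1; apply: contraNneq X'x => ->.
  by rewrite -defH mulG_subl.
have [ox_p | p2] := ox.
  apply: contra (X'x); apply/subsetP/der1_index_pdiv => //.
  by rewrite iX prime_TIg ?indexg1 -?orderE ?ox_p ?cycle_subG.
apply: der1_even_index defH _.
have : p.-nat #|H : X| by rewrite iX; apply: pnat_dvd px; apply: dvdn_indexg.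
have : #|H : X| != 1%N by rewrite iX indexg_eq1 subsetI subxx cycle_subG.
rewrite p2 => i_neq1 /p_natP[[|k] ik]; first by rewrite ik in i_neq1.
by rewrite ik oddX.
Qed.

Definition minimal_cyclics_embedded G H p :=
  forall P, p.-Sylow(H) P -> ~~ cyclic P ->
  forall L, L \subset P -> cyclic L ->
    prime #|L| \/ [/\ #|L| = 4, p = 2 & ~~ abelian P] ->
    ~~ (L \subset hypercenter G) ->
    has_supersolvable_supplement G L \/ satisfies_triangle G L.

(** The supersolvable supplement is left to the caller, because its treatment
    depends on whether D acts inside H or only normalises a Sylow subgroup. *)
Lemma embedded_res_stable G H P U D p x :
    prime p -> H <| G -> minimal_cyclics_embedded G H p -> p.-Sylow(H) P ->
    U \subset P -> D \subset 'N_G(U) -> x \in U ->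
    #[x] = p \/ [/\ #[x] = 4, p = 2 & ~~ abelian U] ->
    (has_supersolvable_supplement G <[x]>%G -> res_stable p D x) ->
  res_stable p D x.
Proof.
move=> p_pr nsHG embH sylP sUP sDN Ux ox supD.
have [sPH pP _] := and3P sylP; have pU := pgroupS sUP pP.
have sUG := subset_trans sUP (subset_trans sPH (normal_sub nsHG)).
have nt_x : x != 1.
  rewrite -order_gt1; have [-> | [-> //]] := ox; exact: prime_gt1.
have [sDG nUD] := subsetIP sDN.
have [cycP | ncycP] := boolP (cyclic P).
  exact: (cyclic_res_stable p (cyclicS sUP cycP) nUD Ux nt_x).
have [Zx | Z'x] := boolP (x \in hypercenter G).
  apply: res_stable_norm => //; apply: subset_trans (p_residualS p sDG) _.
  apply: subset_trans (hypercenter_cent (mem_p_elt pU Ux) Zx) _.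
  by rewrite -cent_cycle cent_sub.
have sxP : <[x]> \subset P by rewrite cycle_subG (subsetP sUP).
have oX : prime #|<[x]>%G| \/ [/\ #|<[x]>%G| = 4, p = 2 & ~~ abelian P].
  rewrite /= -orderE; have [->|[-> p2 ncU]] := ox; [by left | right; split=> //].
  by apply: contra ncU; apply: abelianS.
have Z'X : ~~ (<[x]>%G \subset hypercenter G) by rewrite cycle_subG.
have [/supD // | tri] := embH P sylP ncycP <[x]>%G sxP (cycle_cyclic x) oX Z'X.
exact: (triangle_res_stable p_pr pU sUG sDN Ux nt_x tri).
Qed.

(** For a p-subgroup U of H, the elements of [U, N_H(U)] lie in H', which forces
    a supersolvable supplement T of <x> to contain H; then the normal series of
    T gives R. So O^p(B(N_H(U)))
    centralises U. As p is the smallest prime divisor of |H|, a p'-element y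
    of N_H(U) is a power of y^(p-1), so y centralises U as well. *)
Lemma smallest_prime_residual G H :
    H <| G -> H :!=: 1 -> minimal_cyclics_embedded G H (pdiv #|H|) ->
  (pdiv #|H|)^'.-group (p_residual (pdiv #|H|) H).
Proof.
move=> nsHG ntH; have p_pr : prime (pdiv #|H|) by rewrite pdiv_prime ?cardG_gt1.
set p := pdiv #|H| in p_pr * => embH; apply: Frobenius_p_residual => U sUH pU.
have [P sylP sUP] := Sylow_superset sUH pU.
set D := 'N_H(U); have sDH : D \subset H := subsetIl _ _.
have cU : p_residual p (strict_residual p D) \subset 'C(U).
  apply: (strict_residual_cent_pgroup p_pr pU (subsetIr _ _)) => x UDx ox.
  have Ux : x \in U by move: UDx; apply: subsetP; rewrite commg_subl subsetIr.
  have H'x : x \in H^`(1) by move: UDx; apply: subsetP; apply: commgSS.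
  apply: (embedded_res_stable p_pr nsHG embH sylP sUP _ Ux ox).
    by rewrite setSI ?normal_sub.
  case=> T [sTG defG ssT].
  have defH : <[x]> * (T :&: H) = H.
    rewrite group_modl ?cycle_subG ?(subsetP sUH) //.
    by move: defG => /= ->; apply/setIidPr/normal_sub.
  have sHT : H \subset T.
    apply/setIidPr; rewrite -{2}defH mulSGid // cycle_subG.
    apply: smallest_prime_supplement H'x defH; first exact: mem_p_elt pU Ux.
    by case: ox => [|[]]; [left | right].
  have T1 : 1%G <*> T = T by rewrite /= joing1G.
  apply: (@supersolvable_res_stable p gT _ 1%G T x ssT); rewrite ?T1 ?norms1 //.
  - exact: subset_trans sDH sHT.
  - by rewrite (subsetP sHT) // (subsetP sUH).
  by rewrite inE -order_gt1; have [->|[-> _ _ //]] := ox; apply: prime_gt1.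
apply/p_residual_subP=> y Dy p'y.
(* A common prime divisor of #[y] and p - 1 would be a divisor of |H| smaller
   than p. *)
have co : coprime #|<[y]>| p.-1.
  rewrite -orderE /coprime eqn_leq gcdn_gt0 order_gt0 andbT leqNgt.
  apply/negP=> gcd_gt1; have r_pr := pdiv_prime gcd_gt1.
  set r := pdiv _ in r_pr; have := pdiv_dvd (gcdn #[y] p.-1); rewrite -/r dvdn_gcd.
  case/andP=> dv_ry dv_rp.
  have le_pr : p <= r.
    apply: pdiv_min_dvd; rewrite ?prime_gt1 // (dvdn_trans dv_ry) //.
    by rewrite order_dvdG // (subsetP sDH).
  have p1_gt0 : 0 < p.-1 by rewrite -subn1 subn_gt0 prime_gt1.
  have := leq_trans le_pr (dvdn_leq p1_gt0 dv_rp).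
  by rewrite leqNgt ltn_predL prime_gt0.
rewrite -(expgK co (cycle_id y)) groupX // (subsetP cU) //.
apply: mem_p_residual; last by rewrite (mem_p_elt p'y) ?mem_cycle.
have /strict_residual_minP[_] := subxx (strict_residual p D); exact.
Qed.

Section Formation.

Variable F : group_class.
Hypotheses (F_formation : formation F) (F_saturated : saturated F).
Hypothesis F_supersolvable : forall (rT : finGroupType) (K : {group rT}),
  supersolvable K -> F K.

(** The group N_G(P) acts on P and covers G / K by the Frattini argument. For a
    supersolvable supplement T of <x>, either KT contains P, hence is G, and the
    normal series of T is used modulo K, or KT meets P in a proper subgroup,
    which gives R inside P. *)
Lemma formation_quotient_residual G H p :
    prime p -> H <| G -> minimal_cyclics_embedded G H p ->
    p^'.-group (p_residual p H) -> F (G / H)%G ->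
  F (G / [group of p_residual p H])%G.
Proof.
move=> p_pr nsHG embH; set K := [group of p_residual p H] => p'K FGH.
have [sHG nHG] := andP nsHG.
have [P sylP] := Sylow_exists p H; have [sPH pP _] := and3P sylP.
have defH : K * P = H := norm_p_residual_Sylow sylP.
have sKH : K \subset H := p_residual_sub p H.
have nKG : G \subset 'N(K) := p_residual_norm p nHG.
have nsKG : K <| G by rewrite /normal (subset_trans sKH).
have sPG := subset_trans sPH sHG.
set D := 'N_G(P); have sDG : D \subset G := subsetIl _ _.
have cP : p_residual p (strict_residual p D) \subset 'C(P).
  apply: (strict_residual_cent_pgroup p_pr pP (subsetIr _ _)) => x PDx ox.
  have Px : x \in P by move: PDx; apply: subsetP; rewrite commg_subl subsetIr.
  apply: (embedded_res_stable p_pr nsHG embH sylP (subxx P) (subxx D) Px ox).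
  case=> T [sTG /= defG ssT]; have nKT := subset_trans sTG nKG.
  have nt_x : x != 1.
    by rewrite -order_gt1; have [->|[-> _ _ //]] := ox; apply: prime_gt1.
  have sxP : <[x]> \subset P by rewrite cycle_subG.
  have sxD : <[x]> \subset D by rewrite (subset_trans sxP) // subsetI sPG normG.
  have defG1 : <[x]> * (K <*> T) = G.
    apply/eqP; rewrite eqEsubset mul_subG ?join_subG ?(normal_sub nsKG) //=.
      by rewrite -{1}defG mulgS ?joing_subr.
    by rewrite (subset_trans sxP).
  (* If P lies in KT then KT = G and the series of T reaches x. *)
  have [sPKT | nsPKT] := boolP (P \subset K <*> T).
    have defG2 : K <*> T = G by rewrite -defG1 mulSGid // (subset_trans sxP).
    apply: (supersolvable_res_stable p ssT nKT); rewrite ?defG2 //.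
      exact: (subsetP sPG).
    apply: contra nt_x => Kx; rewrite -order_eq1; apply/eqP.
    exact: pnat_1 (mem_p_elt pP Px) (mem_p_elt p'K Kx).
  apply: (@p_supplement_res_stable p _ D P (K <*> T :&: P)%G (K <*> T :&: D)%G) => //=.
  - by rewrite subIset // subsetIr orbT.
  - by rewrite normsI // subIset ?normG ?subsetIr ?orbT.
  - by rewrite properE subsetIr subsetI subxx andbT.
  - by rewrite group_modl // defG1; apply/setIidPr.
  have defD : <[x]> * (K <*> T :&: D) = D.
    by rewrite group_modl // defG1; apply/setIidPr.
  apply: (@subset_trans _ _ (<[x]> * (K <*> T :&: D))); first by rewrite defD.
  by rewrite mul_subG ?joing_subr // (subset_trans sxP) ?joing_subl.
have defHK : H / K = P / K by rewrite -defH quotientMidl.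
have defGK : G / K = D / K.
  rewrite -(Frattini_arg nsHG sylP) -/D -defH -mulgA quotientMidl.
  by rewrite mulSGid // subsetI sPG normG.
apply: (formation_p_extension F_formation F_saturated F_supersolvable
          (p := p) (P := (H / K)%G)) => //.
- by rewrite /= defHK quotient_pgroup.
- exact: quotient_normal.
- rewrite /= defGK defHK; apply: strict_residual_quotient_cent cP.
  exact: subset_trans nKG.
by apply/formation_third.
Qed.

(** Induction on |H|, replacing H by its normal complement for the smallest prime
    divisor p of |H|; the Sylow q-subgroups of this complement, for q other
    than p, are Sylow subgroups of H. *)
Theorem formation_of_embedded G H :
    H <| G -> F (G / H)%G -> (forall p, prime p -> minimal_cyclics_embedded G H p) ->
  F G.
Proof.
have [n] := ubnP #|H|; elim: n H => // n IHn H; rewrite ltnS => leHn nsHG FGH embH.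
have [H1 | ntH] := eqVneq (H : {set gT}) 1.
  exact: (proj1 (formation_quotient1 F_formation G H1) FGH).
set p := pdiv #|H|; have p_pr : prime p by rewrite pdiv_prime ?cardG_gt1.
have p'K := smallest_prime_residual nsHG ntH (embH p p_pr).
have FGK := formation_quotient_residual p_pr nsHG (embH p p_pr) p'K FGH.
set K := [group of _] in FGK; have sKH : K \subset H := p_residual_sub p H.
have p_H : p %| #|H| := pdiv_dvd _.
have prKH : K \proper H.
  rewrite properEneq sKH andbT; apply: contraTneq p_H => <-.
  by rewrite -p'natE.
apply: (IHn K) => //; first exact: leq_trans (proper_card prKH) leHn.
  have [sHG nHG] := andP nsHG; apply/andP; split; first exact: subset_trans sKH sHG.
  exact: p_residual_norm.
move=> q q_pr Q sylQ ncycQ; apply: (embH q q_pr) => //.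
have ne_qp : q != p.
  apply: contraNneq ncycQ => eq_qp; rewrite eq_qp in sylQ.
  suffices -> : Q :=: 1 by apply: cyclic1.
  have p'Q : p^'.-group Q := pgroupS (pHall_sub sylQ) p'K.
  apply/eqP; rewrite trivg_card1; apply/eqP.
  exact: pnat_1 (pHall_pgroup sylQ) p'Q.
have [P sylP] := Sylow_exists p H.
rewrite pHallE (subset_trans (pHall_sub sylQ)) //= (card_Hall sylQ).
have p'q : q^'.-group P.
  by apply: sub_in_pnat (pHall_pgroup sylP) => r _ /eqP->; rewrite !inE eq_sym.
have /(congr1 (fun n : nat => n`_q)%N) : (#|K| * #|P| = #|H| * #|K :&: P|)%N.
  by rewrite mul_cardG (norm_p_residual_Sylow sylP).
rewrite !partnM ?cardG_gt0 // (part_p'nat p'q).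
by rewrite (part_p'nat (pgroupS (subsetIr K P) p'q)) !muln1 => ->.
Qed.

End Formation.
End Main.

Theorem theorem3p5 (F : group_class)
  (F_formation : formation F) (F_saturated : saturated F)
  (F_supersolvable : forall (rT : finGroupType) (K : {group rT}),
     supersolvable K -> F rT K)
  (gT : finGroupType) (G : {group gT}) :
  F gT G <->
  exists H : {group gT},
    [/\ H <| G,
        F (coset_of H) (G / H)%G
      & forall (p : nat) (P : {group gT}),
          prime p -> p.-Sylow(H) P -> ~~ cyclic P ->
          forall L : {group gT},
            L \subset P -> cyclic L ->
            prime #|L| \/ [/\ #|L| = 4, p = 2 & ~~ abelian P] ->
            ~~ (L \subset hypercenter G) ->
            has_supersolvable_supplement G L \/ satisfies_triangle G L].
Proof.
split=> [FG | [H [nsHG FGH embH]]]; last first.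
  apply: (formation_of_embedded F_formation F_saturated F_supersolvable nsHG FGH).
  by move=> p p_pr P; apply: embH.
exists 1%G; split; first exact: normal1.
  exact: (formation_quotient F_formation (normal1 G)).
move=> p P _ sylP /negP[]; suffices -> : P :=: 1 by apply: cyclic1.
by apply/trivgP/(pHall_sub sylP).
Qed.
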